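(* Let $A\in\mathcal{L}(X,Y)$ and let $\Sigma_\varepsilon$ be an injective covariance operator on $Y$ such that the compatibility assumption between $\Sigma_\varepsilon$ and $A$ holds. Let $\mathcal{B}\subset\mathcal{L}(\ell^2,X)$ be a compact set of operators such that $AB$ is finite basis injective for every $B\in\mathcal{B}$. Let $Q\ge 0$. Then there exists a constant $c_{\rm ST}=c_{\rm ST}(\mathcal{B},A,\Sigma_\varepsilon,Q)$, depending only on $\mathcal{B},A,\Sigma_\varepsilon,Q$, such that for every $y\in Y$ with $\|y\|_Y\le Q$ and every $B_1,B_2\in\mathcal{B}$, $$\|R_{B_1}(y)-R_{B_2}(y)\|_X\le c_{\rm ST}\,\|B_1-B_2\|.$$
   Context: $X,Y$ are real separable Hilbert spaces; $\mathcal{L}(\cdot,\cdot)$ denotes bounded linear operators with the operator norm $\|\cdot\|$ (compactness of $\mathcal{B}$ is with respect to this norm); $\ell^2=\ell^2(\mathbb{N})$ with $\mathbb{N}=\{1,2,\dots\}$ and canonical basis $(e_i)$. $\Sigma_\varepsilon\colon Y\to Y$ is the covariance operator of a zero-mean square-integrable $Y$-valued random variable $\varepsilon$ (hence it is self-adjoint, positive and trace class) and is assumed injective; $\Sigma_\varepsilon^{-1}$ and $\Sigma_\varepsilon^{-1/2}$ denote the (possibly unbounded) inverses of $\Sigma_\varepsilon$ and $\Sigma_\varepsilon^{1/2}$, defined on $\operatorname{Im}(\Sigma_\varepsilon)$ and $\operatorname{Im}(\Sigma_\varepsilon^{1/2})$ respectively. Compatibility assumption: $\operatorname{Im}(A)\subset\operatorname{Im}(\Sigma_\varepsilon)$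 and $\Sigma_\varepsilon^{-1}A\colon X\to Y$ is a compact operator. Finite basis injectivity of $AB$: for every finite $I\subset\mathbb{N}$, the restriction of $AB$ to $\ell^2_I:=\operatorname{span}\{e_i:i\in I\}$ is injective. The reconstruction map: $R_B(y)=B\hat u_B(y)$, where $\hat u_B(y)\in\ell^2$ is the unique minimizer over $u\in\ell^2$ of $$J_B(u)=\frac12\|\Sigma_\varepsilon^{-1/2}ABu\|_Y^2-\langle y,\Sigma_\varepsilon^{-1}ABu\rangle_Y+\|u\|_{\ell^1}$$ (with $\|u\|_{\ell^1}=+\infty$ for $u\in\ell^2\setminus\ell^1$); existence and uniqueness of this minimizer hold for every $y\in Y$ and every $B\in\mathcal{L}(\ell^2,X)$ such that $AB$ is finite basis injective, whenever $A\in\mathcal{L}(X,Y)$, $\Sigma_\varepsilon$ is an injective covariance operator on $Y$, $\operatorname{Im}(A)\subset\operatorname{Im}(\Sigma_\varepsilon)$ and $\Sigma_\varepsilon^{-1}A\colon X\to Y$ is compact. *)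

(* Defs.v *)
From HB Require Import structures.
From mathcomp Require Import all_boot all_order all_algebra.
From mathcomp Require Import finmap ring.
From mathcomp Require Import all_classical all_reals all_analysis.
Import Order.TTheory GRing.Theory Num.Theory.
Import numFieldNormedType.Exports.

Set Implicit Arguments.
Unset Strict Implicit.
Unset Printing Implicit Defensive.

Local Open Scope classical_set_scope.
Local Open Scope ring_scope.

HB.mixin Record NormedModule_isHilbert (R : realType) V
    & NormedModule R V := {
  hinner : {dot V for (@idfun R)};
  hinner_norm : forall x : V, hinner x x = `|x| ^+ 2
}.

#[short(type="hilbertType")]
HB.structure Definition Hilbert (R : realType) :=
  {V of CompleteNormedModule R V & NormedModule_isHilbert R V}.

Definition separable (T : topologicalType) :=
  exists2 D : set T, countable D & dense D.

Section BoundedOp.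
Context (R : realType) (X Y : normedModType R).

Definition is_bounded_linear (f : X -> Y) : Prop :=
  linear f /\ exists M : R, forall x, `|f x| <= M * `|x|.

Definition bounded_linear : {pred X -> Y} := fun f => `[< is_bounded_linear f >].

Record bounded_op := BoundedOp {
  bounded_op_fun :> X -> Y;
  bounded_opP : bounded_op_fun \in bounded_linear }.

HB.instance Definition _ := [isSub for bounded_op_fun].
HB.instance Definition _ := [Choice of bounded_op by <:].

Fact bounded_linear_submod_closed : submod_closed bounded_linear.
Proof.
split.
  apply/asboolP; split=> [a x y|]; first by change (0 = a *: 0 + 0 :> Y); rewrite scaler0 addr0.
  by exists 0 => x; change (`|0 : Y| <= 0 * `|x|); rewrite mul0r normr0.
move=> a f g /asboolP[fl [M fM]] /asboolP[gl [N gN]]; apply/asboolP; split.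
  move=> b x y; rewrite !fctE fl gl !scalerDr !scalerA mulrC -!addrA.
  by congr (_ + _); rewrite addrCA.
exists (`|a| * M + N) => x; rewrite !fctE mulrDl -mulrA.
rewrite (le_trans (ler_normD _ _))// lerD// normrZ.
by rewrite ler_wpM2l.
Qed.
HB.instance Definition _ :=
  GRing.isSubmodClosed.Build R (X -> Y) bounded_linear
    bounded_linear_submod_closed.
HB.instance Definition _ := [SubChoice_isSubLmodule of bounded_op by <:].

Lemma bounded_op_linear (f : bounded_op) : linear f.
Proof. by have /asboolP[] := bounded_opP f. Qed.

HB.instance Definition _ (f : bounded_op) :=
  GRing.isLinear.Build R X Y *:%R f (bounded_op_linear f).

Definition opnorm (f : bounded_op) : R :=
  sup [set `|f x| | x in [set x : X | `|x| <= 1]].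

Fact opnorm_has_sup (f : bounded_op) :
  has_sup [set `|f x| | x in [set x : X | `|x| <= 1]].
Proof.
split; first by exists `|f 0|; exists 0 => //=; rewrite normr0.
have /asboolP[_ [M fM]] := bounded_opP f.
exists `|M| => _ [x /= x1 <-]; rewrite (le_trans (fM x))//.
rewrite (le_trans (ler_norm _))// normrM normr_id.
by rewrite ler_piMr.
Qed.

Fact opnorm_ub (f : bounded_op) x : `|x| <= 1 -> `|f x| <= opnorm f.
Proof.
by move=> x1; apply: sup_upper_bound; [exact: opnorm_has_sup|exists x].
Qed.

Fact opnorm_ge0 (f : bounded_op) : 0 <= opnorm f.
Proof. by rewrite (le_trans _ (@opnorm_ub f 0 _))// normr0. Qed.

Fact opnorm_le (f : bounded_op) M :
  (forall x, `|x| <= 1 -> `|f x| <= M) -> opnorm f <= M.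
Proof.
move=> fM; apply: ge_sup; first by have [] := opnorm_has_sup f.
by move=> _ [x /= x1 <-]; exact: fM.
Qed.

Lemma opnormP (f : bounded_op) x : `|f x| <= opnorm f * `|x|.
Proof.
have [->|x0] := eqVneq x 0; first by rewrite linear0 !normr0 mulr0.
have nx : 0 < `|x| by rewrite normr_gt0.
have : `|f (`|x|^-1 *: x)| <= opnorm f.
  by apply: opnorm_ub; rewrite normrZ normfV normr_id mulVf ?gt_eqF.
by rewrite linearZ normrZ normfV normr_id -ler_pdivlMl ?invr_gt0// invrK mulrC.
Qed.

Fact ler_opnormD (f g : bounded_op) : opnorm (f + g) <= opnorm f + opnorm g.
Proof.
apply: opnorm_le => x x1; rewrite (le_trans (ler_normD _ _))//.
by rewrite lerD// opnorm_ub.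
Qed.

Fact opnormZ_le a (f : bounded_op) : opnorm (a *: f) <= `|a| * opnorm f.
Proof.
by apply: opnorm_le => x x1; rewrite normrZ ler_wpM2l// opnorm_ub.
Qed.

Fact opnormZ a (f : bounded_op) : opnorm (a *: f) = `|a| * opnorm f.
Proof.
apply/eqP; rewrite eq_le opnormZ_le/=.
have [a0|a0] := eqVneq a 0; first by rewrite a0 normr0 mul0r opnorm_ge0.
rewrite -ler_pdivlMl ?normr_gt0// -normfV.
by rewrite -{1}(scale1r f) -(mulVf a0) -scalerA opnormZ_le.
Qed.

Fact opnorm_eq0 (f : bounded_op) : opnorm f = 0 -> f = 0.
Proof.
move=> f0; apply/val_inj/funext => x /=; apply/eqP; rewrite -normr_le0.
by rewrite (le_trans (opnormP f x))// f0 mul0r.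
Qed.

HB.instance Definition _ := Lmodule_isNormed.Build R bounded_op
  ler_opnormD opnormZ opnorm_eq0.

End BoundedOp.

(* Sequences are indexed from 0, where the usual convention for l^2(N) is 1. *)

Section Ell2.
Context (R : realType).

Definition square_summable : {pred nat -> R} :=
  fun u => `[< cvgn (series (fun i => u i ^+ 2 : R)) >].

Record ell2 := Ell2 {
  ell2_seq :> nat -> R;
  ell2P : ell2_seq \in square_summable }.

HB.instance Definition _ := [isSub for ell2_seq].
HB.instance Definition _ := [Choice of ell2 by <:].

Fact square_summable_submod_closed : submod_closed square_summable.
Proof.
split.
  apply/asboolP; rewrite (_ : series _ = fun=> 0); first exact: is_cvg_cst.
  apply/funext => n; rewrite /series/= big1// => i _.
  by change ((0 : R) ^+ 2 = 0); rewrite expr0n.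
move=> a u v /asboolP cu /asboolP cv; apply/asboolP.
pose w n : R := 2 * a ^+ 2 * u n ^+ 2 + 2 * v n ^+ 2.
apply: (@series_le_cvg R _ w).
- by move=> n; exact: sqr_ge0.
- move=> n; apply: addr_ge0.
    by apply: mulr_ge0; [apply: mulr_ge0 => //|]; exact: sqr_ge0.
  by apply: mulr_ge0 => //; exact: sqr_ge0.
- move=> n; rewrite -subr_ge0 /w.
  change (0 <= 2 * a ^+ 2 * u n ^+ 2 + 2 * v n ^+ 2 - (a * u n + v n) ^+ 2).
  rewrite (_ : _ - _ = (a * u n - v n) ^+ 2) ?sqr_ge0//.
  by move: (u n : R) (v n : R) => x y; ring.
- have -> : w = 2 * a ^+ 2 *: (fun i => u i ^+ 2 : R)
                + 2 *: (fun i => v i ^+ 2 : R) by [].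
  by apply: is_cvg_seriesD; exact: is_cvg_seriesZ.
Qed.
HB.instance Definition _ :=
  GRing.isSubmodClosed.Build R (nat -> R) square_summable
    square_summable_submod_closed.
HB.instance Definition _ := [SubChoice_isSubLmodule of ell2 by <:].

Definition ell2_norm (u : ell2) : R :=
  Num.sqrt (limn (series (fun i => u i ^+ 2 : R))).


Let sq (u : nat -> R) i := u i ^+ 2.

Fact ell2_cvg (u : ell2) : cvgn (series (sq u)).
Proof. exact/asboolP/(ell2P u). Qed.

Fact ell2_lim_ge0 (u : ell2) : 0 <= limn (series (sq u)).
Proof.
rewrite (le_trans _ (nondecreasing_cvgn_le _ (@ell2_cvg u) 0%N))//.
  by rewrite /series/= big_geq.
by apply: nondecreasing_series => n _ _; exact: sqr_ge0.
Qed.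

Fact sqr_ell2_norm (u : ell2) : ell2_norm u ^+ 2 = limn (series (sq u)).
Proof. by rewrite sqr_sqrtr// ell2_lim_ge0. Qed.

Fact ell2_norm_ge0 (u : ell2) : 0 <= ell2_norm u.
Proof. exact: sqrtr_ge0. Qed.

Fact ell2_coord_le (u : ell2) i : `|u i| <= ell2_norm u.
Proof.
rewrite -(@ler_sqr _ `|u i|) ?nnegrE ?ell2_norm_ge0// sqr_ell2_norm.
rewrite real_normK ?num_real//.
apply: (@le_trans _ _ (series (sq u) i.+1)).
  by rewrite /series/= big_nat_recr//= lerDr sumr_ge0// => j _; exact: sqr_ge0.
apply: nondecreasing_cvgn_le; last exact: ell2_cvg.
by apply: nondecreasing_series => n _ _; exact: sqr_ge0.
Qed.

Fact ell2_norm_eq0 (u : ell2) : ell2_norm u = 0 -> u = 0.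
Proof.
move=> u0; apply/val_inj/funext => i /=; apply/eqP; rewrite -normr_le0 -u0.
exact: ell2_coord_le.
Qed.

Fact ell2_normZ a (u : ell2) : ell2_norm (a *: u) = `|a| * ell2_norm u.
Proof.
rewrite /ell2_norm (_ : (fun _ => _) = a ^+ 2 *: (sq u : nat -> R)).
  rewrite lim_seriesZ; last exact: ell2_cvg.
  by rewrite sqrtrM ?sqr_ge0// sqrtr_sqr.
by apply/funext => i; exact: (@exprMn R 2 a (u i)).
Qed.

Fact ler_ell2_normD (u v : ell2) :
  ell2_norm (u + v) <= ell2_norm u + ell2_norm v.
Proof.
have [u0|u0] := eqVneq (ell2_norm u) 0.
  by rewrite (ell2_norm_eq0 u0) add0r lerDr ell2_norm_ge0.
have [v0|v0] := eqVneq (ell2_norm v) 0.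
  by rewrite (ell2_norm_eq0 v0) addr0 lerDl ell2_norm_ge0.
have {}u0 : 0 < ell2_norm u by rewrite lt0r u0 ell2_norm_ge0.
have {}v0 : 0 < ell2_norm v by rewrite lt0r v0 ell2_norm_ge0.
move: (sqr_ell2_norm u) (sqr_ell2_norm v) u0 v0.
set a := ell2_norm u; set b := ell2_norm v => ua vb a0 b0.
rewrite -ler_sqr ?nnegrE ?ell2_norm_ge0 ?addr_ge0 ?(ltW a0) ?(ltW b0)// sqr_ell2_norm.
rewrite (_ : _ ^+ 2 = (a + b) / a * a ^+ 2 + (a + b) / b * b ^+ 2); last first.
  by field; rewrite !gt_eqF.
have cu : cvgn (series (((a + b) / a) *: (sq u : nat -> R))).
  exact: is_cvg_seriesZ (@ell2_cvg u).
have cv : cvgn (series (((a + b) / b) *: (sq v : nat -> R))).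
  exact: is_cvg_seriesZ (@ell2_cvg v).
have -> : (a + b) / a * a ^+ 2 =
    limn (series (((a + b) / a) *: (sq u : nat -> R))).
  by rewrite lim_seriesZ ?ua//; exact: ell2_cvg.
have -> : (a + b) / b * b ^+ 2 =
    limn (series (((a + b) / b) *: (sq v : nat -> R))).
  by rewrite lim_seriesZ ?vb//; exact: ell2_cvg.
rewrite -lim_seriesD//.
apply: (@lim_series_le R (sq (u + v : ell2))
  ((a + b) / a *: (sq u : nat -> R) + (a + b) / b *: (sq v : nat -> R))).
- exact: ell2_cvg.
- exact: is_cvg_seriesD.
move=> n.
change ((u n + v n) ^+ 2 <= (a + b) / a * u n ^+ 2 + (a + b) / b * v n ^+ 2).
rewrite -subr_ge0 (_ : _ - _ = (b * u n - a * v n) ^+ 2 / (a * b)).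
  by rewrite divr_ge0 ?sqr_ge0// mulr_ge0 ?ltW.
by field; rewrite !gt_eqF.
Qed.

HB.instance Definition _ := Lmodule_isNormed.Build R ell2
  ler_ell2_normD ell2_normZ ell2_norm_eq0.

Fact ell2_basis_subproof i :
  (fun j => (j == i)%:R : R) \in square_summable.
Proof.
apply/asboolP; apply: (cvgP (1 : R)); apply: cvg_near_cst; near=> n.
rewrite /series/= big_mkord.
have ni : (i < n)%N by near: n; exact: nbhs_infty_gt.
rewrite (bigD1 (Ordinal ni))//= eqxx expr1n big1 ?addr0// => j ji.
by rewrite (negbTE (ji : (j != i :> nat))) expr0n.
Unshelve. all: by end_near. Qed.

Definition ell2_basis i : ell2 := Ell2 (ell2_basis_subproof i).

Definition ell2_span (I : {fset nat}) : set ell2 :=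
  [set u | exists c : nat -> R, u = \sum_(i <- I) c i *: ell2_basis i].

Definition ell1_norm (u : nat -> R) : \bar R := (\sum_(i <oo) `|u i|%:E)%E.

End Ell2.

Definition compact_operator (R : realType) (X Y : normedModType R)
    (f : X -> Y) : Prop :=
  linear f /\ forall S : set X, bounded_set S -> precompact (f @` S).

(* The inverse of an injective map, defined on its range and extended by 0 to
   the whole codomain. *)
Definition range_inv (R : realType) (X Y : normedModType R) (f : X -> Y) :
    Y -> X :=
  'pinv_(fun=> 0) setT f.

Section Covariance.
Context (R : realType) (Y : hilbertType R).

Definition positive_operator (T : bounded_op Y Y) : Prop :=
  (forall x y, hinner (T x) y = hinner x (T y)) /\
  forall x, 0 <= hinner (T x) x.

(* A positive T has exactly one positive square root; [xget] names it, with
   default 0. *)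
Definition op_sqrt (T : bounded_op Y Y) : bounded_op Y Y :=
  xget 0 [set S | positive_operator S /\ forall y, S (S y) = T y].

(* [eps] is a Borel random variable with finite second moment; its mean and
   covariance operator are characterized weakly, by E<eps, y> = <mean, y> and
   <Sigma y, z> = E[<eps, y><eps, z>]. *)
Definition is_covariance_of d (Omega : measurableType d)
    (P : probability Omega R) (eps : Omega -> Y) (Sigma : bounded_op Y Y) :=
  [/\ measurable_fun setT (eps : Omega -> g_sigma_algebraType (@open Y)),
      ('E_P[fun w => (`|eps w| ^+ 2)%R] < +oo)%E,
      forall y, ('E_P[fun w => hinner (eps w) y] = 0)%E &
      forall y z,
        ('E_P[fun w => (hinner (eps w) y * hinner (eps w) z)%R] =
         (hinner (Sigma y) z)%:E)%E].

Definition covariance_operator (Sigma : bounded_op Y Y) : Prop :=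
  exists d (Omega : measurableType d) (P : probability Omega R)
    (eps : Omega -> Y), is_covariance_of P eps Sigma.

End Covariance.

Section Reconstruction.
Context (R : realType) (X Y : hilbertType R).
Variables (A : bounded_op X Y) (Sigma : bounded_op Y Y).

Definition compatible : Prop :=
  range A `<=` range Sigma /\ compact_operator (range_inv Sigma \o A).

Definition finite_basis_injective (B : bounded_op (ell2 R) X) : Prop :=
  forall I : {fset nat}, set_inj (ell2_span I) (A \o B).

Definition objective (B : bounded_op (ell2 R) X) (y : Y) (u : ell2 R) :
    \bar R :=
  ((2^-1 * `|range_inv (op_sqrt Sigma) (A (B u))| ^+ 2
    - hinner y (range_inv Sigma (A (B u))))%:E + ell1_norm u)%E.

(* Under [compatible] and [finite_basis_injective] the minimizer exists and is
   unique, so that the default 0 is never used. *)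
Definition minimizer (B : bounded_op (ell2 R) X) (y : Y) : ell2 R :=
  xget 0 [set u | forall v, (objective B y u <= objective B y v)%E].

Definition reconstruction (B : bounded_op (ell2 R) X) (y : Y) : X :=
  B (minimizer B y).

End Reconstruction.

(* Main.v *)
(** Write K = Sigma^-1 A (compact) and S = Sigma^(1/2), so that the objective is
    1/2 |S K B u|^2 - <y, K B u> + |u|_1.  Since S is injective, Ehrling's
    inequality |K x| <= eta |x| + C |S K x| bounds |u|_1 uniformly on the sublevel
    set of 0.  As K is compact and the family of operators B is compact,
    |K B e_i| tends to 0 uniformly in B; hence beyond some index N, common to all
    B and y, cutting off the tail of u strictly decreases the objective, and all
    minimizers live in span(e_0, ..., e_(N-1)).  There finite basis injectivity
    and compactness give |u| <= C2 |S K B u| uniformly in B.  Adding the strong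
    convexity inequalities of the objectives of B1 and B2 at their minimizers
    u1, u2 yields |u1 - u2|^2 <= const |B1 - B2| |u1 - u2|. *)

Require Import Defs.
From HB Require Import structures.
From mathcomp Require Import all_boot all_order all_algebra.
From mathcomp Require Import finmap ring lra.
From mathcomp Require Import all_classical all_reals all_analysis.
Import Order.TTheory GRing.Theory Num.Theory.
Import numFieldNormedType.Exports.

Local Open Scope classical_set_scope.
Local Open Scope ring_scope.

Set Implicit Arguments.
Unset Strict Implicit.
Unset Printing Implicit Defensive.

(** * Bounded operators and inner products *)

Section BoundedOpTheory.
Context (R : realType).

Lemma bounded_opD (X Y : normedModType R) (f : bounded_op X Y) x y :
  f (x + y) = f x + f y.
Proof. exact: linearD. Qed.

Lemma bounded_opN (X Y : normedModType R) (f : bounded_op X Y) x : f (- x) = - f x.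
Proof. exact: linearN. Qed.

Lemma bounded_opB (X Y : normedModType R) (f : bounded_op X Y) x y :
  f (x - y) = f x - f y.
Proof. exact: linearB. Qed.

Lemma bounded_opZ (X Y : normedModType R) (f : bounded_op X Y) a x :
  f (a *: x) = a *: f x.
Proof. exact: linearZ. Qed.

Lemma bounded_op0 (X Y : normedModType R) (f : bounded_op X Y) : f 0 = 0.
Proof. exact: linear0. Qed.

Lemma bounded_op_sum (X Y : normedModType R) (f : bounded_op X Y) I (r : seq I)
    (P : pred I) (F : I -> X) :
  f (\sum_(i <- r | P i) F i) = \sum_(i <- r | P i) f (F i).
Proof. exact: linear_sum. Qed.

Lemma bounded_op_le (X Y : normedModType R) (f : bounded_op X Y) x :
  `|f x| <= `|f| * `|x|.
Proof. exact: opnormP. Qed.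

Lemma ex_bounded_op (X Y : normedModType R) (f : X -> Y) (M : R) :
  linear f -> (forall x, `|f x| <= M * `|x|) ->
  exists F : bounded_op X Y, F =1 f.
Proof.
move=> fl fM; have fb : f \in @bounded_linear R X Y by apply/asboolP; split=> //; exists M.
by exists (BoundedOp fb).
Qed.

Lemma bounded_op_comp_ex (X Y Z : normedModType R) (g : bounded_op Y Z)
    (f : bounded_op X Y) : exists F : bounded_op X Z, F =1 g \o f.
Proof.
apply: (@ex_bounded_op _ _ _ (`|g| * `|f|)) => [a x y|x] /=.
  by rewrite bounded_opD bounded_opZ bounded_opD bounded_opZ.
rewrite (le_trans (bounded_op_le _ _))// -mulrA ler_wpM2l//.
exact: bounded_op_le.
Qed.

Definition bounded_comp (X Y Z : normedModType R) (g : bounded_op Y Z)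
  (f : bounded_op X Y) : bounded_op X Z := projT1 (cid (bounded_op_comp_ex g f)).

Lemma bounded_compE (X Y Z : normedModType R) (g : bounded_op Y Z)
  (f : bounded_op X Y) x : bounded_comp g f x = g (f x).
Proof. by rewrite /bounded_comp; case: cid => /= F ->. Qed.

Lemma bounded_op_continuous (X Y : normedModType R) (f : bounded_op X Y) :
  continuous f.
Proof.
move=> x; apply/cvgrPdist_le => e e0.
(* Adding 1 keeps the divisor positive when [f] is 0; the same device recurs below. *)
have M0 : 0 < `|f| + 1 by rewrite ltr_wpDl.
near=> y; rewrite -bounded_opB (le_trans (bounded_op_le _ _))//.
rewrite (@le_trans _ _ ((`|f| + 1) * `|x - y|))// ?ler_wpM2r ?lerDl//.
rewrite -ler_pdivlMl// mulrC; near: y.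
by apply: cvgr_dist_le => //; rewrite divr_gt0.
Unshelve. all: by end_near. Qed.

End BoundedOpTheory.

(** Evaluate at the vertex [- b / c]. If [c] is 0 the polynomial is affine and, unless [b] is 0,
    takes the value -1 somewhere. *)
Lemma discriminant_le (R : realFieldType) (a b c : R) : 0 <= c ->
  (forall t, 0 <= a + 2 * b * t + c * t ^+ 2) -> b ^+ 2 <= a * c.
Proof.
rewrite le_eqVlt => /predU1P[<-|c0] h.
  have [->|b0] := eqVneq b 0; first by rewrite expr0n mulr0.
  have := h (- (a + 1) / (2 * b)).
  by rewrite (_ : _ + _ = - 1) ?oppr_ge0 ?ler10//; field.
have := h (- b / c).
rewrite (_ : _ + _ = (a * c - b ^+ 2) / c); last by field; rewrite gt_eqF.
by rewrite pmulr_lge0 ?invr_gt0// subr_ge0.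
Qed.

Section InnerProduct.
Context (R : realType) (V : hilbertType R).
Implicit Types x y z : V.

Local Notation "''[' x , y ]" := (hinner x y).

Lemma hinnerC x y : '[x, y] = '[y, x].
Proof. by rewrite hermC expr0 mul1r. Qed.

Lemma hinnerDl x y z : '[x + y, z] = '[x, z] + '[y, z].
Proof. exact: linearDl. Qed.

Lemma hinnerDr x y z : '[x, y + z] = '[x, y] + '[x, z].
Proof. exact: linearDr. Qed.

Lemma hinnerNl x y : '[- x, y] = - '[x, y].
Proof. exact: linearNl. Qed.

Lemma hinnerNr x y : '[x, - y] = - '[x, y].
Proof. exact: linearNr. Qed.

Lemma hinnerBl x y z : '[x - y, z] = '[x, z] - '[y, z].
Proof. exact: linearBl. Qed.

Lemma hinnerBr x y z : '[x, y - z] = '[x, y] - '[x, z].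
Proof. exact: linearBr. Qed.

Lemma hinnerZl a x y : '[a *: x, y] = a * '[x, y].
Proof. exact: linearZl_LR. Qed.

Lemma hinnerZr a x y : '[x, a *: y] = a * '[x, y].
Proof. by rewrite hinnerC hinnerZl hinnerC. Qed.

Definition hinnerE :=
  (hinnerDl, hinnerDr, hinnerBl, hinnerBr, hinnerNl, hinnerNr, hinnerZl, hinnerZr).

Lemma hinner_ge0 x : 0 <= '[x, x].
Proof. by rewrite hinner_norm sqr_ge0. Qed.

Lemma sqr_normD x y : `|x + y| ^+ 2 = `|x| ^+ 2 + 2 * '[x, y] + `|y| ^+ 2.
Proof. by rewrite -!hinner_norm !hinnerE (hinnerC y); ring. Qed.

(** Discriminant bound for the polynomial <T (x + t y), x + t y> in t, which positivity of [T] keeps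
    nonnegative. *)
Lemma psd_CauchySchwarz (T : bounded_op V V) : positive_operator T ->
  forall x y, '[T x, y] ^+ 2 <= '[T x, x] * '[T y, y].
Proof.
move=> [Tsym Tge0] x y; apply: discriminant_le => // t.
have := Tge0 (x + t *: y); rewrite bounded_opD bounded_opZ !hinnerE.
rewrite (Tsym y x) (hinnerC y); congr (_ <= _); ring.
Qed.

Lemma CauchySchwarz x y : `|'[x, y]| <= `|x| * `|y|.
Proof.
rewrite -ler_sqr ?nnegrE ?mulr_ge0// real_normK ?num_real// exprMn -!hinner_norm.
apply: discriminant_le (hinner_ge0 y) _ => t.
have := hinner_ge0 (x + t *: y); rewrite !hinnerE (hinnerC y).
congr (_ <= _); ring.
Qed.

Lemma hinner_le x y : '[x, y] <= `|x| * `|y|.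
Proof. exact: le_trans (ler_norm _) (CauchySchwarz x y). Qed.

Lemma cvg_hinnerl (u : V^nat) x y : u @ \oo --> x -> (fun n => '[u n, y]) @ \oo --> '[x, y].
Proof.
move=> ux; apply/cvgrPdist_le => e e0.
have y1 : 0 < `|y| + 1 by rewrite ltr_wpDl.
have /cvgrPdist_le/(_ (e / (`|y| + 1))) := ux.
rewrite divr_gt0// => /(_ isT); apply: filterS => n un.
rewrite -hinnerBl (le_trans (CauchySchwarz _ _))//.
rewrite (le_trans (ler_wpM2r _ un))// -mulrA ler_piMr ?(ltW e0)//.
by rewrite ler_pdivrMl// mulr1 lerDl.
Qed.

End InnerProduct.

(** * Square roots of positive operators *)

Section SquareRoot.
Context (R : realType) (V : hilbertType R).
Implicit Types (x y : V) (C : bounded_op V V).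

(** The iteration below for the scalar [C = 1]; its terms and increments dominate those of the
    iterates of any contraction. *)
Fixpoint sqrt_majorant n : R :=
  if n is m.+1 then 2^-1 * (1 + sqrt_majorant m ^+ 2) else 0.

Fixpoint sqrt_iter C n : bounded_op V V :=
  if n is m.+1 then 2^-1 *: (C + bounded_comp (sqrt_iter C m) (sqrt_iter C m)) else 0.

Lemma sqrt_iterS C n x :
  sqrt_iter C n.+1 x = 2^-1 *: (C x + sqrt_iter C n (sqrt_iter C n x)).
Proof. by rewrite -bounded_compE. Qed.

Lemma sqrt_majorant_itv n : 0 <= sqrt_majorant n <= 1.
Proof.
elim: n => [|n /andP[s0 s1]] /=; first by rewrite lexx ler01.
by have := exprn_ile1 2 s0 s1; have := sqr_ge0 (sqrt_majorant n); lra.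
Qed.

Lemma sqrt_majorant_ndecr : nondecreasing_seq sqrt_majorant.
Proof.
apply/nondecreasing_seqP => n /=.
have := sqr_ge0 (1 - sqrt_majorant n); rewrite sqrrB expr1n; lra.
Qed.

Lemma sqrt_majorant_cvg : cvgn sqrt_majorant.
Proof.
apply: nondecreasing_is_cvgn; first exact: sqrt_majorant_ndecr.
by exists 1 => _ [n _ <-]; case/andP: (sqrt_majorant_itv n).
Qed.

Lemma sqrt_iter_comm C n x : sqrt_iter C n (C x) = C (sqrt_iter C n x).
Proof.
elim: n x => [|n IH] x; first by rewrite [RHS]bounded_op0.
by rewrite !sqrt_iterS bounded_opZ bounded_opD !IH.
Qed.

(** All iterates are polynomials in [C]. This commutation lets a difference of squares factor as for
    scalars. *)
Lemma sqrt_iter_commS C n x :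
  sqrt_iter C n (sqrt_iter C n.+1 x) = sqrt_iter C n.+1 (sqrt_iter C n x).
Proof. by rewrite !sqrt_iterS bounded_opZ bounded_opD sqrt_iter_comm. Qed.

Lemma sqrt_iter_sym C n : (forall x y, hinner (C x) y = hinner x (C y)) ->
  forall x y, hinner (sqrt_iter C n x) y = hinner x (sqrt_iter C n y).
Proof.
move=> Csym; elim: n => [|n IH] x y; first by rewrite /= linear0l linear0r.
by rewrite !sqrt_iterS !hinnerE Csym !IH.
Qed.

Lemma sqrt_iter_le C n x : (forall y, `|C y| <= `|y|) ->
  `|sqrt_iter C n x| <= sqrt_majorant n * `|x|.
Proof.
move=> C1; elim: n x => [|n IH] x; first by rewrite /= normr0 mul0r.
rewrite sqrt_iterS normrZ ger0_norm// /= -mulrA ler_wpM2l// mulrDl mul1r.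
rewrite (le_trans (ler_normD _ _))// lerD// (le_trans (IH _))//.
rewrite expr2 -mulrA ler_wpM2l//.
by case/andP: (sqrt_majorant_itv n).
Qed.

(** Writing Y_n for the iterates, which commute, Y_(n+1)^2 - Y_n^2 = (Y_(n+1) + Y_n) (Y_(n+1) -
    Y_n); the majorant obeys the same recursion, so the bound passes from n to n + 1. *)
Lemma sqrt_iter_succ C n x : (forall y, `|C y| <= `|y|) ->
  `|sqrt_iter C n.+1 x - sqrt_iter C n x|
    <= (sqrt_majorant n.+1 - sqrt_majorant n) * `|x|.
Proof.
move=> C1; elim: n x => [|n IH] x.
  have := sqrt_iter_le 1 x C1; rewrite [sqrt_iter C 0 x](_ : _ = 0)//.
  by rewrite subr0 /= subr0.
set D := sqrt_iter C n.+1 x - sqrt_iter C n x.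
have -> : sqrt_iter C n.+2 x - sqrt_iter C n.+1 x =
    2^-1 *: (sqrt_iter C n.+1 D + sqrt_iter C n D).
  rewrite [sqrt_iter C n.+2 x]sqrt_iterS [in X in _ - X]sqrt_iterS.
  rewrite -scalerBr /D !bounded_opB -sqrt_iter_commS; congr (_ *: _).
  by rewrite opprD addrACA subrr add0r addrA subrK.
rewrite normrZ ger0_norm//.
have -> : sqrt_majorant n.+2 - sqrt_majorant n.+1 =
    2^-1 * ((sqrt_majorant n.+1 + sqrt_majorant n)
            * (sqrt_majorant n.+1 - sqrt_majorant n)).
  by rewrite /=; move: (sqrt_majorant n) => a; field.
rewrite -!mulrA ler_wpM2l// (le_trans (ler_normD _ _))//.
have s0 k : 0 <= sqrt_majorant k by case/andP: (sqrt_majorant_itv k).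
by rewrite mulrDl; apply: lerD; rewrite (le_trans (sqrt_iter_le _ _ C1))// ler_wpM2l// IH.
Qed.

Lemma sqrt_iter_dist C m n x : (forall y, `|C y| <= `|y|) -> (m <= n)%N ->
  `|sqrt_iter C n x - sqrt_iter C m x|
    <= (sqrt_majorant n - sqrt_majorant m) * `|x|.
Proof.
move=> C1; elim: n => [|n IH].
  by rewrite leqn0 => /eqP->; rewrite !subrr normr0 mul0r.
rewrite leq_eqVlt => /predU1P[->|]; first by rewrite !subrr normr0 mul0r.
rewrite ltnS => /IH {}IH.
rewrite -[X in `|X|](subrKA (sqrt_iter C n x)) (le_trans (ler_normD _ _))//.
rewrite -[X in X * _](subrKA (sqrt_majorant n)) mulrDl lerD//.
exact: sqrt_iter_succ.
Qed.

(** Increments are dominated by those of a convergent real sequence, so the iterates at [x] are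
    Cauchy in the complete space [V]. *)
Lemma sqrt_iter_cvg C x : (forall y, `|C y| <= `|y|) ->
  cvgn (fun n => sqrt_iter C n x).
Proof.
move=> C1; apply/cauchy_cvgP/cauchy_exP => e e0.
have x1 : 0 < `|x| + 1 by rewrite ltr_wpDl.
pose l := limn sqrt_majorant.
have /cvgrPdist_lt/(_ (e / (`|x| + 1))) := sqrt_majorant_cvg.
rewrite divr_gt0// => /(_ isT)[N _ HN].
exists (sqrt_iter C N x); exists N => // n /= Nn.
rewrite -ball_normE /= distrC (le_lt_trans (sqrt_iter_dist _ C1 Nn))//.
have sN : 0 <= sqrt_majorant n - sqrt_majorant N.
  by rewrite subr_ge0; apply: sqrt_majorant_ndecr.
rewrite (@le_lt_trans _ _ ((sqrt_majorant n - sqrt_majorant N) * (`|x| + 1)))//.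
  by rewrite ler_wpM2l// lerDl.
rewrite -ltr_pdivlMr//; apply: le_lt_trans (HN N _) => //=.
rewrite (le_trans _ (ler_norm _))// lerB//.
by apply: nondecreasing_cvgn_le sqrt_majorant_cvg _; exact: sqrt_majorant_ndecr.
Qed.

(** [Z] is the pointwise limit of the iterates; symmetry, the norm bound and the recursion pass to
    the limit. *)
Lemma contraction_sqrt C :
  (forall x y, hinner (C x) y = hinner x (C y)) -> (forall x, `|C x| <= `|x|) ->
  exists Z : bounded_op V V,
    [/\ forall x y, hinner (Z x) y = hinner x (Z y), forall x, `|Z x| <= `|x|
      & forall x, Z x = 2^-1 *: (C x + Z (Z x))].
Proof.
move=> Csym C1.
pose z x := limn (fun n => sqrt_iter C n x).
have zE x : (fun n => sqrt_iter C n x) @ \oo --> z x by exact: sqrt_iter_cvg.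
have Y1 n x : `|sqrt_iter C n x| <= `|x|.
  rewrite (le_trans (sqrt_iter_le n x C1))// ler_piMl//.
  by case/andP: (sqrt_majorant_itv n).
have z1 x : `|z x| <= 1 * `|x|.
  rewrite mul1r; apply: cvgr_to_le (cvg_norm (zE x)) _.
  by apply: nearW => n; exact: Y1.
have zl : linear z.
  move=> a x y; apply: cvg_lim => //.
  under eq_fun do rewrite bounded_opD bounded_opZ.
  by apply: cvgD => //; apply: cvgZ => //; exact: cvg_cst.
have [Z ZE] := ex_bounded_op zl z1.
exists Z; split => [x y|x|x]; rewrite ?ZE.
- have h1 : (fun n => hinner (sqrt_iter C n x) y) @ \oo --> hinner (z x) y.
    exact: cvg_hinnerl.
  have h2 : (fun n => hinner (sqrt_iter C n x) y) @ \oo --> hinner x (z y).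
    under eq_fun do rewrite sqrt_iter_sym// hinnerC.
    by rewrite hinnerC; exact: cvg_hinnerl.
  exact: cvg_unique h1 h2.
- by rewrite -[X in _ <= X]mul1r.
- have h1 : (fun n => sqrt_iter C n.+1 x) @ \oo --> z x.
    by rewrite (cvg_shiftS (fun n => sqrt_iter C n x)).
  suff h2 : (fun n => sqrt_iter C n.+1 x) @ \oo --> 2^-1 *: (C x + z (z x)).
    exact: cvg_unique h1 h2.
  under eq_fun do rewrite sqrt_iterS.
  apply: cvgZ; first exact: cvg_cst.
  apply: cvgD; first exact: cvg_cst.
  apply/cvgrPdist_le => e e0; have e2 : 0 < e / 2 by rewrite divr_gt0.
  have /cvgrPdist_le/(_ _ e2) H1 := zE (z x).
  have /cvgrPdist_le/(_ _ e2) H2 := zE x.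
  near=> n.
  (* Convergence is only pointwise: z (z x) - Y_n (Y_n x) is split as (z (z x) - Y_n (z x)) + Y_n (z
     x - Y_n x), and |Y_n v| <= |v| controls the second term. *)
  rewrite -(subrKA (sqrt_iter C n (z x))) (le_trans (ler_normD _ _))//.
  rewrite (splitr e) lerD//; first by near: n.
  by rewrite -bounded_opB (le_trans (Y1 _ _))//; near: n.
Unshelve. all: by end_near. Qed.

(* With [0 <= C = 1 - T / M <= 1], the limit [Z] of the iteration
   [Y <- (C + Y^2) / 2] satisfies [(1 - Z)^2 = 1 - C]. *)
Lemma positive_operator_sqrt (T : bounded_op V V) : positive_operator T ->
  exists S, positive_operator S /\ forall y, S (S y) = T y.
Proof.
move=> Tpos; have [Tsym Tge0] := Tpos.
pose M := `|T| + 1; have M0 : 0 < M by rewrite ltr_wpDl.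
have [I IE] : exists I : bounded_op V V, I =1 id.
  by apply: (@ex_bounded_op _ _ _ _ 1) => // x; rewrite mul1r.
pose C : bounded_op V V := I - M^-1 *: T.
have CE x : C x = x - M^-1 *: T x by rewrite -{2}(IE x).
have Csym x y : hinner (C x) y = hinner x (C y) by rewrite !CE !hinnerE Tsym.
have Cle x : hinner (C x) x <= `|x| ^+ 2.
  rewrite CE !hinnerE hinner_norm gerBl mulr_ge0// invr_ge0 ltW//.
have Cpos : positive_operator C.
  split=> // x; rewrite CE !hinnerE subr_ge0 hinner_norm ler_pdivrMl//.
  rewrite (le_trans (hinner_le _ _))// expr2 mulrA ler_wpM2r//.
  by rewrite (le_trans (bounded_op_le _ _))// ler_wpM2r// lerDl.
(* Cauchy-Schwarz for the form of [C], at [x] and [C x], gives |C x|^4 <= <C x, x> <C (C x), C x> <=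
   |x|^2 |C x|^2. *)
have C1 x : `|C x| <= `|x|.
  have [->|Cx0] := eqVneq (C x) 0; first by rewrite normr0.
  have := psd_CauchySchwarz Cpos x (C x).
  rewrite hinner_norm => h; rewrite -ler_sqr ?nnegrE//.
  have Cx2 : 0 < `|C x| ^+ 2 by rewrite exprn_gt0// normr_gt0.
  rewrite -(ler_pM2r Cx2) -expr2 (le_trans h)//.
  by apply: ler_pM => //; [case: Cpos|case: Cpos].
have [Z [Zsym Z1 ZE]] := contraction_sqrt Csym C1.
pose S : bounded_op V V := Num.sqrt M *: (I - Z).
have SE x : S x = Num.sqrt M *: (x - Z x) by rewrite -{2}(IE x).
exists S; split.
  split=> [x y|x]; first by rewrite !SE !hinnerE Zsym.
  rewrite SE !hinnerE mulr_ge0 ?sqrtr_ge0// subr_ge0 (le_trans (hinner_le _ _))//.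
  by rewrite hinner_norm expr2 ler_wpM2r.
move=> y; rewrite !SE bounded_opZ -scalerBr scalerA -expr2 sqr_sqrtr ?(ltW M0)//.
rewrite bounded_opB.
(* The fixed-point equation cleared of its factor 1/2; it reduces (1 - Z)^2 y to y - C y = T y /
   M. *)
have -> : Z (Z y) = Z y + Z y - C y.
  have -> : Z y + Z y = C y + Z (Z y).
    by rewrite -mulr2n -scaler_nat [in LHS]ZE scalerA divff ?pnatr_eq0// scale1r.
  by rewrite addrC addKr.
rewrite CE opprB (addrAC (_ + _)) addrK addrA subrK opprB addrC subrK.
by rewrite scalerA divff ?gt_eqF// scale1r.
Qed.

End SquareRoot.

(** * Compact operators *)

Lemma covariance_positive (R : realType) (Y : hilbertType R) (Sigma : bounded_op Y Y) :
  covariance_operator Sigma -> positive_operator Sigma.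
Proof.
move=> [d [W [P [eps [_ _ _ covE]]]]]; split=> [x y|x].
  apply: EFin_inj; rewrite (hinnerC x) -!covE.
  by under eq_fun do rewrite mulrC.
by rewrite -lee_fin -covE expectation_ge0// => w; rewrite -expr2 sqr_ge0.
Qed.

(** Existence of a root rules out the default 0 of [xget]. *)
Lemma op_sqrtP (R : realType) (Y : hilbertType R) (Sigma : bounded_op Y Y) :
  positive_operator Sigma ->
  positive_operator (op_sqrt Sigma) /\ forall y, op_sqrt Sigma (op_sqrt Sigma y) = Sigma y.
Proof.
move=> /positive_operator_sqrt[S HS].
apply: (@xgetPex _ 0 [set S | positive_operator S /\ forall y, S (S y) = Sigma y]).
by exists S.
Qed.

Lemma range_invK (R : realType) (X Y : normedModType R) (f : X -> Y) :
  injective f -> cancel f (range_inv f).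
Proof. by move=> finj x; apply: pinvKV; rewrite ?inE// => a b _ _; exact: finj. Qed.

Lemma bounded_set_ball (R : realType) (X : normedModType R) (r : R) :
  bounded_set [set x : X | `|x| <= r].
Proof.
exists r; split; first exact: num_real.
by move=> M rM x /= xr; rewrite (le_trans xr)// ltW.
Qed.

Lemma norm_unit (R : realType) (X : normedModType R) (x : X) : x != 0 ->
  `| `|x|^-1 *: x | = 1.
Proof. by move=> x0; rewrite normrZ normfV normr_id mulVf// normr_eq0. Qed.

(** The image of the unit ball has compact closure, hence is bounded. This turns Sigma^-1 A, given
    as a bare function, into a [bounded_op]. *)
Lemma compact_operator_bounded (R : realType) (X Y : normedModType R) (f : X -> Y) :
  compact_operator f -> exists F : bounded_op X Y, F =1 f.
Proof.
move=> [fl /(_ _ (bounded_set_ball X 1))]; rewrite precompactE => /compact_bounded.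
move=> [M [_ /(_ (M + 1))]]; rewrite ltrDl ltr01 => /(_ isT) fM.
have fZ a x : f (a *: x) = a *: f x.
  have f0 : f 0 = 0.
    by have := fl 1 0 0; rewrite !scale1r addr0 -{1}[f 0]addr0 => /addrI.
  by rewrite -[a *: x]addr0 fl f0 addr0.
have f0 : f 0 = 0 by rewrite -(scale0r 0) fZ scale0r.
apply: (@ex_bounded_op _ _ _ _ (M + 1)) => // x.
have [->|x0] := eqVneq x 0; first by rewrite f0 !normr0 mulr0.
have nx : 0 < `|x| by rewrite normr_gt0.
have : `|f (`|x|^-1 *: x)| <= M + 1.
  by apply/fM/subset_closure; exists (`|x|^-1 *: x) => //=; rewrite norm_unit.
rewrite fZ normrZ normfV normr_id.
by rewrite mulrC ler_pdivrMr.
Qed.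

Lemma closed_norm_ge (R : realType) (X : normedModType R) (r : R) :
  closed [set x : X | r <= `|x|].
Proof.
exact: ((continuous_closedP _).1 (@norm_continuous _ X) _ (@closed_ge _ r)).
Qed.

Lemma compact_norm_min (R : realType) (X Y : normedModType R) (f : bounded_op X Y)
    (D : set X) : D !=set0 -> compact D ->
  exists2 c, D c & forall x, D x -> `|f c| <= `|f x|.
Proof.
move=> D0 cD.
have fc : {within D, continuous (fun x => `|f x|)}.
  apply: continuous_subspaceT => x.
  apply: (@continuous_comp _ _ _ f (fun y : Y => `|y|)); first exact: bounded_op_continuous.
  exact: norm_continuous.
have [c /set_mem Dc cmin] := compact_EVT_min D0 cD fc.
by exists c => // x Dx; apply: cmin; exact/mem_set.
Qed.

Lemma compact_norm_bounded (R : realType) (V : normedModType R) (D : set V) :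
  compact D -> exists2 M, 0 <= M & forall x, D x -> `|x| <= M.
Proof.
move=> /compact_bounded[M [_ HM]].
exists (`|M| + 1) => [|x Dx]; first by rewrite addr_ge0.
by apply: HM => //; rewrite (le_lt_trans (ler_norm _))// ltrDl.
Qed.

(** On the part of the compact closure of K(unit ball) where |z| >= eta, the injective [S] does not
    vanish, so |S z| has a positive minimum there; elsewhere [eta] alone suffices. Homogeneity
    extends the bound beyond the unit ball. *)
Lemma ehrling (R : realType) (X Y Z : normedModType R) (K : bounded_op X Y)
    (S : bounded_op Y Z) (eta : R) :
  compact_operator K -> injective S -> 0 < eta ->
  exists2 C, 0 <= C & forall x, `|K x| <= eta * `|x| + C * `|S (K x)|.
Proof.
move=> [_ /(_ _ (bounded_set_ball X 1))]; rewrite precompactE.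
set B := closure _ => cB Sinj eta0.
suff [C C0 HC] : exists2 C, 0 <= C &
    forall x, `|x| <= 1 -> `|K x| <= eta + C * `|S (K x)|.
  exists C => // x.
  have [->|x0] := eqVneq x 0; first by rewrite !bounded_op0 !normr0 !mulr0 addr0.
  have nx : 0 < `|x| by rewrite normr_gt0.
  have := HC (`|x|^-1 *: x); rewrite norm_unit// lexx => /(_ isT).
  rewrite !bounded_opZ !normrZ normfV normr_id => h.
  rewrite (_ : _ + _ = `|x| * (eta + C * (`|x|^-1 * `|S (K x)|))); last first.
    by field; rewrite gt_eqF.
  by rewrite -ler_pdivrMl.
have BK x : `|x| <= 1 -> B (K x) by move=> x1; apply: subset_closure; exists x.
pose D := B `&` [set z | eta <= `|z|].
have cD : compact D by apply: compact_closedI => //; exact: closed_norm_ge.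
have [[z0 Dz0]|D0] := pselect (D !=set0); last first.
  exists 0 => // x x1; rewrite mul0r addr0 leNgt; apply/negP => /ltW xe.
  by apply: D0; exists (K x); split => //; exact: BK.
have [c [Bc /= ce] cmin] := compact_norm_min S (ex_intro _ _ Dz0) cD.
have Sc0 : 0 < `|S c|.
  rewrite normr_gt0; apply: contraTneq ce => Sc; rewrite -ltNge.
  by rewrite (Sinj c 0) ?bounded_op0// normr0.
(* When |x| <= 1 and |K x| >= eta, one has |K x| <= |K| and |S c| <= |S (K x)|. *)
exists (`|K| / `|S c|) => [|x x1]; first by rewrite divr_ge0.
have [xe|xe] := ltP `|K x| eta.
  by rewrite (le_trans (ltW xe))// lerDl mulr_ge0// divr_ge0.
rewrite ler_wpDl ?(ltW eta0)// mulrAC ler_pdivlMr//.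
apply: ler_pM => //; last by apply: cmin; split => //; exact: BK.
by rewrite (le_trans (bounded_op_le _ _))// ler_piMr.
Qed.

(** * Sequence spaces *)

Section Ell2Theory.
Context (R : realType).
Implicit Types (u v w : ell2 R) (a : nat -> R).

(** Applied to some [u : ell2 R] through the coercion, this is the truncation of [u] to its first
    [N] coordinates. *)
Definition ell2_fin N a : ell2 R := \sum_(i < N) a i *: ell2_basis R i.

Lemma ell2_finE N a i : ell2_fin N a i = if (i < N)%N then a i else 0.
Proof.
rewrite /ell2_fin; elim: N => [|N IH]; first by rewrite big_ord0 ltn0.
rewrite big_ord_recr; transitivity (ell2_fin N a i + a N * (i == N)%:R) => //.
rewrite [in LHS]/ell2_fin IH ltnS (leq_eqVlt i).
by case: eqP => [->|_]; rewrite /= mulr_natr ?ltnn ?add0r ?mulr1n ?mulr0n ?addr0.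
Qed.

Lemma ell2_ext u v : u =1 v -> u = v.
Proof. by move=> uv; apply/val_inj/funext. Qed.

Lemma ell2_fin_supp N u : (forall i, (N <= i)%N -> u i = 0) -> u = ell2_fin N u.
Proof. by move=> u0; apply: ell2_ext => i; rewrite ell2_finE; case: ltnP => // /u0. Qed.

Lemma series_sqr_cvg u : series (fun i => u i ^+ 2 : R) @ \oo --> `|u| ^+ 2.
Proof. by rewrite [ `|u| ]/(ell2_norm u) sqr_ell2_norm; exact: ell2_cvg. Qed.

Lemma sqr_norm_ell2_fin N a : `|ell2_fin N a| ^+ 2 = \sum_(i < N) a i ^+ 2.
Proof.
suff h : series (fun i => ell2_fin N a i ^+ 2 : R) @ \oo --> \sum_(i < N) a i ^+ 2.
  exact: cvg_unique (@series_sqr_cvg _) h.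
apply: cvg_near_cst; exists N => // n /= Nn.
rewrite /series /= (big_cat_nat _ Nn)//= [X in _ + X]big_nat_cond [X in _ + X]big1 ?addr0.
  by rewrite big_mkord; apply: eq_bigr => i _; rewrite ell2_finE ltn_ord.
by move=> i /andP[/andP[Ni _] _]; rewrite ell2_finE ltnNge Ni expr0n.
Qed.

Lemma sqr_norm_ell2_tail N u :
  `|u - ell2_fin N u| ^+ 2 = `|u| ^+ 2 - \sum_(i < N) u i ^+ 2.
Proof.
suff h : series (fun i => (u - ell2_fin N u : ell2 R) i ^+ 2 : R) @ \oo -->
    `|u| ^+ 2 - \sum_(i < N) u i ^+ 2.
  exact: cvg_unique (@series_sqr_cvg _) h.
apply: (@cvg_trans _ ((series (fun i => u i ^+ 2 : R)
    - cst (\sum_(i < N) u i ^+ 2)) @ \oo)).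
  apply: near_eq_cvg; exists N => // n /= Nn.
  rewrite /series /= !fctE !(big_cat_nat (leq0n N) Nn) /= big_mkord addrAC subrr add0r.
  rewrite [X in _ = X + _]big_mkord [X in _ = X + _]big1 ?add0r => [|i _].
    by apply: eq_big_nat => i /andP[Ni _]; rewrite ell2_finE ltnNge Ni subr0.
  by rewrite ell2_finE ltn_ord subrr expr0n.
by apply: cvgB; [exact: series_sqr_cvg|exact: cvg_cst].
Qed.

Lemma ell2_fin_cvg u : (fun n => ell2_fin n u) @ \oo --> u.
Proof.
apply/cvgrPdist_le => e e0.
have /cvgrPdist_le/(_ (e ^+ 2)) := @series_sqr_cvg u.
rewrite exprn_gt0// => /(_ isT); apply: filterS => n /(le_trans (ler_norm _)).
rewrite /series /= big_mkord -sqr_norm_ell2_tail ler_sqr ?nnegrE//.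
exact: ltW.
Qed.

Lemma norm_ell2_basis i : `|ell2_basis R i| = 1.
Proof.
apply: (@pexpIrn _ 2) => //; rewrite ?nnegrE//.
rewrite (_ : ell2_basis R i = ell2_fin i.+1 (fun j => (j == i)%:R)).
  rewrite sqr_norm_ell2_fin big_ord_recr /= eqxx expr1n big1 ?add0r// => j _.
  by rewrite ltn_eqF ?expr0n.
apply: ell2_ext => j; rewrite ell2_finE ltnS.
by case: leqP => //; rewrite /= => ij; rewrite gtn_eqF.
Qed.

Lemma ell1_norm_ge0 u : (0 <= ell1_norm u)%E.
Proof. by apply: nneseries_ge0 => i _ _; rewrite lee_fin. Qed.

Lemma ell1_norm_fin N a : ell1_norm (ell2_fin N a) = (\sum_(i < N) `|a i|)%:E.
Proof.
rewrite /ell1_norm (@nneseries_split _ _ 0 N); last by move=> i _; rewrite lee_fin.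
rewrite add0n eseries0 ?adde0 => [|i Ni _]; last by rewrite ell2_finE ltnNge Ni normr0.
by rewrite big_mkord sumEFin; congr _%:E; apply: eq_bigr => i _; rewrite ell2_finE ltn_ord.
Qed.

Lemma ell1_norm_split N u :
  ell1_norm u = ((\sum_(i < N) `|u i|)%:E + ell1_norm (u - ell2_fin N u)%R)%E.
Proof.
rewrite -ell1_norm_fin -nneseriesD; try by move=> i _ _; rewrite lee_fin.
apply: eq_eseriesr => i _.
rewrite (_ : (u - ell2_fin N u) i = u i - ell2_fin N u i)// ell2_finE.
by case: ifP => _; rewrite ?subrr ?normr0 ?adde0 ?subr0 ?add0e.
Qed.

Lemma sum_le_ell1_norm N u : ((\sum_(i < N) `|u i|)%:E <= ell1_norm u)%E.
Proof. by rewrite [leRHS](ell1_norm_split N) leeDl// ell1_norm_ge0. Qed.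

(** [T u] is the limit of the sums of u_i T e_i over i < n, since truncations converge in l^2 and
    [T] is continuous; the triangle inequality bounds each sum. *)
Lemma ell1_tail_le (Y : normedModType R) (T : bounded_op (ell2 R) Y) N u (delta m : R) :
  0 <= delta -> (forall i, (i < N)%N -> u i = 0) ->
  (forall i, (N <= i)%N -> `|T (ell2_basis R i)| <= delta) ->
  (ell1_norm u <= m%:E)%E -> `|T u| <= delta * m.
Proof.
move=> delta0 u0 Td um.
have Tu : (fun n => T (ell2_fin n u)) @ \oo --> T u.
  exact: (cvg_comp _ _ (@ell2_fin_cvg u) (@bounded_op_continuous _ _ _ T u)).
apply: cvgr_to_le (cvg_norm Tu) _; apply: nearW => n.
rewrite /ell2_fin bounded_op_sum (le_trans (ler_norm_sum _ _ _))//.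
apply: (@le_trans _ _ (\sum_(i < n) delta * `|u i|)).
  apply: ler_sum => i _; rewrite bounded_opZ normrZ.
  by case: (ltnP i N) => [/u0->|/Td Ti]; rewrite ?normr0 ?mul0r ?mulr0// mulrC ler_wpM2r.
rewrite -mulr_sumr ler_wpM2l// -lee_fin.
exact: le_trans (sum_le_ell1_norm n u) um.
Qed.

Lemma norm_le_ell1 u m : (ell1_norm u <= m%:E)%E -> `|u| <= m.
Proof.
have [I IE] : exists I : bounded_op (ell2 R) (ell2 R), I =1 id.
  by apply: (@ex_bounded_op _ _ _ _ 1) => // x; rewrite mul1r.
(* The embedding of l^1 in l^2 has norm at most 1: this is the tail bound for the identity, with
   [N = 0] and [delta = 1]. *)
move=> um; rewrite -(IE u) -(mul1r m); apply: (@ell1_tail_le _ I 0) => // i _.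
by rewrite IE norm_ell2_basis.
Qed.

End Ell2Theory.

(* If [T e_i] were within [r] of [z] for [m] indices [i], the sum of these
   [e_i], of norm [sqrt m], would be mapped to a vector of norm at least
   [m (|z| - r)]. *)
Lemma basis_image_escapes (R : realType) (Y : normedModType R)
    (T : bounded_op (ell2 R) Y) (z : Y) (r : R) : r < `|z| ->
  \forall i \near \oo, r < `|T (ell2_basis R i) - z|.
Proof.
move=> rz; apply: contrapT => Tz.
(* [a] marks the bad indices, those with T e_i within [r] of [z], and [m n] counts them below
   [n]. *)
pose a i : R := (`|T (ell2_basis R i) - z| <= r)%R%:R.
pose m n : R := \sum_(i < n) a i.
have a0 i : 0 <= a i by rewrite /a ler0n.
have m0 n : 0 <= m n by apply: sumr_ge0.
have mS n : m n.+1 = m n + a n by rewrite /m big_ord_recr.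
have m_ndecr : nondecreasing_seq m by apply/nondecreasing_seqP => n; rewrite mS lerDl.
have mT n : m n * (`|z| - r) <= `|T| * Num.sqrt (m n).
  have -> : Num.sqrt (m n) = `|ell2_fin n a|.
    rewrite -[RHS]ger0_norm// -sqrtr_sqr sqr_norm_ell2_fin; congr Num.sqrt.
    apply: eq_bigr => i _; rewrite /a.
    by case: (_ <= _); rewrite ?expr1n// expr0n.
  rewrite (le_trans _ (bounded_op_le _ _))// /ell2_fin bounded_op_sum.
  rewrite mulrBr lerBlDr -{1}(ger0_norm (m0 n)) -normrZ.
  have -> : m n *: z = \sum_(i < n) T (a i *: ell2_basis R i)
                     - \sum_(i < n) a i *: (T (ell2_basis R i) - z).
    rewrite /m scaler_suml -sumrB; apply: eq_bigr => i _.
    by rewrite bounded_opZ scalerBr opprB addrC subrK.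
  rewrite (le_trans (ler_normB _ _))// lerD2l (le_trans (ler_norm_sum _ _ _))//.
  rewrite /m mulr_suml; apply: ler_sum => i _; rewrite normrZ ger0_norm//.
  by rewrite /a; case: (leP _ r); rewrite ?mul1r ?mul0r.
(* Dividing by the square root of [m n] bounds the count independently of [n]. *)
have mc n : m n <= (`|T| / (`|z| - r)) ^+ 2.
  have rz0 : 0 < `|z| - r by rewrite subr_gt0.
  have [->|mn0] := eqVneq (m n) 0; first exact: sqr_ge0.
  have {}mn0 : 0 < m n by rewrite lt0r mn0 m0.
  rewrite -[leLHS]sqr_sqrtr// ler_sqr ?nnegrE ?sqrtr_ge0 ?divr_ge0 ?(ltW rz0)//.
  rewrite ler_pdivlMr// -(ler_pM2r (x := Num.sqrt (m n))) ?sqrtr_gt0//.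
  by rewrite mulrAC -expr2 sqr_sqrtr.
(* If the claim fails, bad indices occur beyond every bound, so the count reaches every integer. *)
have munb k : exists n, k%:R <= m n.
  elim: k => [|k [n kn]]; first by exists 0%N; rewrite m0.
  have [i ni ai] : exists2 i, (n <= i)%N & `|T (ell2_basis R i) - z| <= r.
    apply: contrapT => h; apply: Tz; exists n => // i /= ni.
    by rewrite ltNge; apply/negP => hi; apply: h; exists i.
  exists i.+1; rewrite mS /a ai -natr1 lerD2r (le_trans kn)//; exact: m_ndecr.
have [n] := munb (Num.truncn ((`|T| / (`|z| - r)) ^+ 2)).+1.
by apply/negP; rewrite -ltNge (le_lt_trans (mc n))// truncnS_gt.
Qed.

(** All K B e_i lie in a compact set. Near a point of norm at most delta/2 every vector is shorter
    than [delta]; near any other point, the K B e_i eventually leave the ball of radius delta/4. *)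
Lemma compact_operator_basis (R : realType) (X Y : normedModType R)
    (K : bounded_op X Y) (B : bounded_op (ell2 R) X) (delta : R) :
  compact_operator K -> 0 < delta ->
  \forall i \near \oo, `|K (B (ell2_basis R i))| < delta.
Proof.
move=> [_ /(_ _ (bounded_set_ball X `|B|))]; rewrite precompactE.
set Z := closure _ => cZ delta0.
have ZK i : Z (K (B (ell2_basis R i))).
  apply: subset_closure; exists (B (ell2_basis R i)) => //=.
  by rewrite (le_trans (bounded_op_le _ _))// norm_ell2_basis mulr1.
have d4 : 0 < delta / 4 by rewrite divr_gt0.
(* The implication makes the claim a property of the pair (i, z), to which the near-covering form of
   compactness applies; z = K B e_i recovers the goal. *)
have /(_ _ \oo (fun i z => z = K (B (ell2_basis R i)) -> `|z| < delta)) :=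
  (compact_near_coveringP Z).1 cZ.
suff H : forall z, Z z -> \forall z' \near z & i \near \oo,
    z' = K (B (ell2_basis R i)) -> `|z'| < delta.
  by move=> /(_ _ H); apply: filterS => i; apply.
move=> z _; have [zd|zd] := leP `|z| (delta / 2).
  exists (ball z (delta / 4), setT) => [|[z' i] [/= zz' _] _].
    by split; [exact: nbhsx_ballx|exact: filterT].
  rewrite -[z'](subrKC z) (le_lt_trans (ler_normD _ _))//.
  by move: zz'; rewrite -ball_normE /= distrC; lra.
have d4z : delta / 4 < `|z| by lra.
exists (ball z (delta / 4), [set i | delta / 4 < `|bounded_comp K B (ell2_basis R i) - z|]).
  by split; [exact: nbhsx_ballx|exact: basis_image_escapes].
move=> [z' i] [/= zz' Ti] z'E; move: Ti.
rewrite bounded_compE -z'E distrC ltNge => /negP[]; apply/ltW.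
by move: zz'; rewrite -ball_normE.
Qed.

(** Since |e_i| = 1, a small change of [B] in operator norm moves K B e_i by at most delta/2 for all
    i at once; compactness then yields a common index. *)
Lemma compact_operator_basis_unif (R : realType) (X Y : normedModType R)
    (K : bounded_op X Y) (BB : set (bounded_op (ell2 R) X)) (delta : R) :
  compact_operator K -> compact BB -> 0 < delta ->
  \forall N \near \oo, forall i B, (N <= i)%N -> BB B ->
    `|K (B (ell2_basis R i))| <= delta.
Proof.
move=> cK cB delta0.
have /(_ _ \oo (fun i B => `|K (B (ell2_basis R i))| <= delta)) :=
  (compact_near_coveringP BB).1 cB.
suff H : forall B, BB B -> \forall B' \near B & i \near \oo,
    `|K ((B' : bounded_op (ell2 R) X) (ell2_basis R i))| <= delta.
  move=> /(_ _ H)[N _ HN]; exists N => // n /= Nn i B ni BB_B.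
  by apply: HN => //=; exact: leq_trans ni.
move=> B _; have d2 : 0 < delta / 2 by rewrite divr_gt0.
have K0 : 0 < `|K| + 1 by rewrite ltr_wpDl.
have dK : 0 < delta / 2 / (`|K| + 1) by rewrite divr_gt0.
exists (ball B (delta / 2 / (`|K| + 1)),
    [set i | `|K (B (ell2_basis R i))| < delta / 2]).
  by split; [exact: nbhsx_ballx|exact: compact_operator_basis].
move=> [B' i] [/=]; rewrite -ball_normE /= => BB' Bi.
rewrite -[B'](subrK B) (_ : (B' - B + B) _ =
  (B' - B) (ell2_basis R i) + B (ell2_basis R i))//.
rewrite bounded_opD (le_trans (ler_normD _ _))// (splitr delta) lerD ?(ltW Bi)//.
rewrite (le_trans (bounded_op_le _ _))//.
rewrite (@le_trans _ _ ((`|K| + 1) * `|B' - B|))//.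
  apply: ler_pM => //; first by rewrite lerDl.
  by rewrite (le_trans (bounded_op_le _ _))// norm_ell2_basis mulr1.
by rewrite -ler_pdivlMl// mulrC distrC ltW.
Qed.

(** * Finitely supported sequences *)

Section FiniteSupport.
Context (R : realType).
Implicit Types (u v : ell2 R).

Definition ell2_supp N : set (ell2 R) := [set u | forall i, (N <= i)%N -> u i = 0].

Lemma ell2_supp_fin N a : ell2_supp N (ell2_fin N a).
Proof. by move=> i Ni; rewrite ell2_finE ltnNge Ni. Qed.

Lemma ell2_suppZ N c u : ell2_supp N u -> ell2_supp N (c *: u).
Proof. by move=> uN i Ni; rewrite (_ : (c *: u) i = c * u i)// uN// mulr0. Qed.

Lemma ell2_suppD N u v : ell2_supp N u -> ell2_supp N v -> ell2_supp N (u + v).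
Proof.
by move=> uN vN i Ni; rewrite (_ : (u + v) i = u i + v i)// uN// vN// addr0.
Qed.

Lemma ell2_suppB N u v : ell2_supp N u -> ell2_supp N v -> ell2_supp N (u - v).
Proof. by move=> uN vN; rewrite -scaleN1r; apply: ell2_suppD => //; exact: ell2_suppZ. Qed.

Lemma ell2_suppE N u : ell2_supp N u -> ell2_fin N u = u.
Proof. by move=> uN; rewrite -ell2_fin_supp. Qed.

Lemma ell1_norm_supp N u : ell2_supp N u -> ell1_norm u = (\sum_(i < N) `|u i|)%:E.
Proof. by move=> uN; rewrite -{1}(ell2_suppE uN) ell1_norm_fin. Qed.

(** The set is the image under the continuous map [e] of a closed subset of R^N, bounded because
    each coordinate is at most the l^2 norm. *)
Lemma compact_ell2_supp_ball N r : compact (ell2_supp N `&` [set u | `|u| <= r]).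
Proof.
pose e (v : 'rV[R]_N) : ell2 R := \sum_(i < N) v ord0 i *: ell2_basis R i.
(* Extension of [w] by 0 past [N], which presents [e w] as an [ell2_fin]. *)
pose a (w : 'rV[R]_N) k := if insub k is Some j then w ord0 (j : 'I_N) else 0.
have ea w : e w = ell2_fin N (a w) by apply: eq_bigr => j _; rewrite /a valK.
have eE w (i : 'I_N) : e w i = w ord0 i by rewrite ea ell2_finE ltn_ord /a valK.
have ec : continuous e.
  apply: continuous_big => [|i _ w]; first exact: add_continuous.
  exact: (cvgZ (@coord_continuous R _ _ ord0 i w) (cvg_cst _)).
pose A := [set v | `|e v| <= r].
have -> : ell2_supp N `&` [set u | `|u| <= r] = e @` A.
  apply/seteqP; split => [u [uN ur]|_ [v vA <-]].
    have eu : e (\row_i u i) = u.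
      by rewrite -[RHS](ell2_suppE uN); apply: eq_bigr => i _; rewrite mxE.
    by exists (\row_i u i) => //=; rewrite /A/= eu.
  by split=> //; rewrite ea; exact: ell2_supp_fin.
apply: continuous_compact; first exact: continuous_subspaceT.
apply: bounded_closed_compact.
  exists r; split; first exact: num_real.
  move=> M rM v /= vA.
  have M0 : 0 <= M by rewrite (le_trans _ (ltW rM))// (le_trans _ vA).
  rewrite [leLHS]/Num.norm /= mx_normrE; apply/bigmax_leP; split => //= -[i j] _ /=.
  by rewrite (ord1 i) -eE (le_trans (ell2_coord_le _ _))// (le_trans vA)// ltW.
have nec : continuous (fun w : 'rV[R]_N => `|e w|).
  by move=> w; exact: (cvg_comp _ _ (ec w) (@norm_continuous _ _ (e w))).
exact: ((continuous_closedP _).1 nec _ (@closed_le _ r)).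
Qed.

(** On the compact unit sphere [D] of a finite-dimensional space, |T u| attains a positive minimum;
    [C] is its inverse. *)
Lemma ell2_supp_lower_bound (Z : normedModType R) (T : bounded_op (ell2 R) Z) N :
  (forall u, ell2_supp N u -> T u = 0 -> u = 0) ->
  exists2 C, 0 < C & forall u, ell2_supp N u -> `|u| <= C * `|T u|.
Proof.
move=> T0.
pose D := ell2_supp N `&` [set u | `|u| <= 1] `&` [set u : ell2 R | 1 <= `|u|].
have cD : compact D.
  apply: compact_closedI; first exact: compact_ell2_supp_ball.
  exact: closed_norm_ge.
(* The sphere is empty only when [N = 0]; the sole vector is then 0. *)
have [[z0 Dz0]|D0] := pselect (D !=set0); last first.
  exists 1 => // u uN; rewrite mul1r.
  have [->|u0] := eqVneq u 0; first by rewrite normr0.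
  exfalso; apply: D0; exists (`|u|^-1 *: u).
  by rewrite /D /= norm_unit//; split=> //; split => //; exact: ell2_suppZ.
have [c [[/= cN _] c1] cmin] := compact_norm_min T (ex_intro _ _ Dz0) cD.
have Tc : 0 < `|T c|.
  rewrite normr_gt0; apply: contraTneq c1 => /(T0 _ cN) ->.
  by rewrite normr0 -ltNge.
exists (`|T c|^-1); rewrite ?invr_gt0// => u uN.
have [->|u0] := eqVneq u 0; first by rewrite normr0 mulr_ge0// invr_ge0 ltW.
rewrite -ler_pdivrMl ?invr_gt0// invrK.
have nu : 0 < `|u| by rewrite normr_gt0.
rewrite -ler_pdivlMr// mulrC.
suff /cmin : D (`|u|^-1 *: u) by rewrite bounded_opZ normrZ normfV normr_id.
by rewrite /D /= norm_unit//; split=> //; split => //; exact: ell2_suppZ.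
Qed.

(** A bound with constant C at [B] persists near [B] with constant 2 C, the perturbation being
    absorbed in |u|. Natural numbers serve as constants, so that compactness of [BB] yields a common
    one. *)
Lemma ell2_supp_lower_bound_unif (X Z : normedModType R) (G : bounded_op X Z)
    (BB : set (bounded_op (ell2 R) X)) N :
  compact BB ->
  (forall B, BB B -> forall u, ell2_supp N u -> G (B u) = 0 -> u = 0) ->
  exists2 C, 0 <= C & forall B u, BB B -> ell2_supp N u -> `|u| <= C * `|G (B u)|.
Proof.
move=> cB GB.
have /(_ _ \oo (fun k B => forall u, ell2_supp N u -> `|u| <= k%:R * `|G (B u)|)) :=
  (compact_near_coveringP BB).1 cB.
suff H : forall B, BB B -> \forall B' \near B & k \near \oo,
    forall u, ell2_supp N u -> `|u| <= k%:R * `|G ((B' : bounded_op (ell2 R) X) u)|.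
  by move=> /(_ _ H)[k _ Hk]; exists k%:R => // B u BB_B; apply: (Hk k) => //=.
move=> B BB_B.
have [|C C0 HC] := @ell2_supp_lower_bound _ (bounded_comp G B) N.
  by move=> u uN; rewrite bounded_compE; exact: GB.
have G0 : 0 < `|G| + 1 by rewrite ltr_wpDl.
(* Chosen so that C (|G| + 1) r = 1/2: the perturbation costs at most |u| / 2. *)
pose r := (2 * C * (`|G| + 1))^-1.
have r0 : 0 < r by rewrite invr_gt0 !mulr_gt0.
exists (ball B r, [set k | 2 * C <= k%:R]).
  by split; [exact: nbhsx_ballx|exact: nbhs_infty_ger].
move=> [B' k] [/=]; rewrite -ball_normE /= => BB' Ck u uN.
have := HC u uN; rewrite bounded_compE.
have -> : B u = B' u + (B - B') u by rewrite (_ : (B - B') u = B u - B' u)// subrKC.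
rewrite bounded_opD => h1.
have h2 : C * `|G ((B - B') u)| <= 2^-1 * `|u|.
  rewrite (@le_trans _ _ (C * ((`|G| + 1) * (r * `|u|))))//.
    rewrite ler_wpM2l ?(ltW C0)// (le_trans (bounded_op_le _ _))//.
    apply: ler_pM => //; first by rewrite lerDl.
    by rewrite (le_trans (bounded_op_le _ _))// ler_wpM2r// ltW.
  rewrite le_eqVlt; apply/orP; left; apply/eqP; rewrite /r.
  by field; rewrite !gt_eqF.
have h3 : `|u| <= 2 * C * `|G (B' u)|.
  have := ler_normD (G (B' u)) (G ((B - B') u)).
  rewrite -(ler_pM2l C0) mulrDr => h4; lra.
by rewrite (le_trans h3)// ler_wpM2r.
Qed.

End FiniteSupport.

(** * The regularized functional *)

Section SparseRegularization.
Context (R : realType) (X Y Z : hilbertType R).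
Context (K : bounded_op X Y) (S : bounded_op Y Z).
Implicit Types (u v w d : ell2 R) (B : bounded_op (ell2 R) X) (y : Y).

(** With K = Sigma^-1 A and S = Sigma^(1/2), the product S K is Sigma^(-1/2) A, so no unbounded
    inverse remains. *)
Definition data_fit B y u : R :=
  2^-1 * `|S (K (B u))| ^+ 2 - hinner y (K (B u)).

Definition sparse_objective B y u : \bar R := ((data_fit B y u)%:E + ell1_norm u)%E.

Lemma data_fitD B y u d :
  data_fit B y (u + d) = data_fit B y u
    + (hinner (S (K (B u))) (S (K (B d))) - hinner y (K (B d)))
    + 2^-1 * `|S (K (B d))| ^+ 2.
Proof. by rewrite /data_fit !bounded_opD sqr_normD hinnerDr; field. Qed.

Lemma sparse_objective0 B y : sparse_objective B y 0 = 0%E.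
Proof.
rewrite /sparse_objective /data_fit !bounded_op0 normr0 linear0r.
rewrite (_ : ell1_norm _ = 0%E) ?adde0 ?expr0n ?mulr0 ?subr0//.
by apply: eseries0 => i _ _; rewrite [X in `|X|](_ : _ = 0)// normr0.
Qed.

Lemma sparse_objective_le0 B y u : (sparse_objective B y u <= 0)%E ->
  exists2 m, ell1_norm u = m%:E & data_fit B y u + m <= 0.
Proof.
rewrite /sparse_objective; case: (ell1_norm u) (ell1_norm_ge0 u) => [m||]//= _ h.
by exists m.
Qed.

(** Put m = |u|_1 and g = |S K B u|. Ehrling's inequality bounds <y, K B u> by m/2 + Q C g, so m/2
    <= Q C g - g^2/2 <= (Q C)^2/2 by completing the square. *)
Lemma sparse_objective_coercive (M Q : R) :
  compact_operator K -> injective S -> 0 <= M -> 0 <= Q ->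
  exists2 C, 0 <= C & forall B y u, `|B| <= M -> `|y| <= Q ->
    (sparse_objective B y u <= 0)%E -> (ell1_norm u <= C%:E)%E.
Proof.
move=> cK Sinj M0 Q0.
(* This [eta] satisfies Q eta M <= 1/2, leaving half of m on the left. *)
have eta0 : 0 < (2 * (Q + 1) * (M + 1))^-1 by rewrite invr_gt0 !mulr_gt0// ltr_wpDl.
have [C C0 HC] := ehrling cK Sinj eta0.
exists ((Q * C) ^+ 2) => [|B y u BM yQ /sparse_objective_le0[m um hm]].
  exact: sqr_ge0.
have um' : `|u| <= m by apply: norm_le_ell1; rewrite um.
have m0 : 0 <= m by rewrite -lee_fin -um ell1_norm_ge0.
rewrite um lee_fin.
set g := `|S (K (B u))|.
have h1 : `|K (B u)| <= (2 * (Q + 1))^-1 * m + C * g.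
  rewrite (le_trans (HC _))// lerD2r invfM -mulrA ler_wpM2l//.
    by rewrite invr_ge0 mulr_ge0// addr_ge0.
  rewrite ler_pdivrMl ?ltr_wpDl//.
  rewrite (le_trans (bounded_op_le _ _))// ler_pM//.
  by rewrite (le_trans BM)// lerDl.
have h2 : hinner y (K (B u)) <= 2^-1 * m + Q * C * g.
  rewrite (le_trans (hinner_le _ _))// (@le_trans _ _ (Q * `|K (B u)|))//.
    by rewrite ler_wpM2r.
  rewrite (le_trans (ler_wpM2l Q0 h1))// mulrDr mulrA (mulrA Q C) lerD2r.
  rewrite ler_wpM2r// invfM mulrCA ler_piMr ?invr_ge0// ler_pdivrMr ?ltr_wpDl// mul1r.
  by rewrite lerDl.
move: hm; rewrite /data_fit -/g.
by have := sqr_ge0 (g - Q * C); rewrite sqrrB; lra.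
Qed.

(** On sequences supported below [N] the l^1 norm is a finite sum, so the objective can be handled
    as a real function. *)
Definition supp_objective N B y u : R := data_fit B y u + \sum_(i < N) `|u i|.

Lemma sparse_objective_supp N B y u : ell2_supp N u ->
  sparse_objective B y u = (supp_objective N B y u)%:E.
Proof. by move=> uN; rewrite /sparse_objective (ell1_norm_supp uN). Qed.

(* Cutting off the coordinates [i >= N] costs at most [Lambda |K (B w)|] in the
   data fit, [w] being the tail, which is at most half of the gain [ell1 w]. *)
Lemma sparse_objective_truncate (M Q C Lambda : R) N B y u :
  Lambda = `|S| ^+ 2 * (3 / 2) * `|K| * M * C + Q -> 0 <= M -> 0 <= C ->
  `|B| <= M -> `|y| <= Q ->
  (forall i, (N <= i)%N -> Lambda * `|K (B (ell2_basis R i))| <= 2^-1) ->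
  (ell1_norm u <= C%:E)%E ->
  exists m, [/\ 0 <= m, ell1_norm (u - ell2_fin N u) = m%:E &
    ((supp_objective N B y (ell2_fin N u) + 2^-1 * m)%:E <= sparse_objective B y u)%E].
Proof.
move=> LE M0 C0 BM yQ KB uC.
pose w := u - ell2_fin N u.
have usplit := ell1_norm_split N u.
have w_ge0 := ell1_norm_ge0 w.
have wC : (ell1_norm w <= C%:E)%E.
  by rewrite (le_trans _ uC)// usplit leeDr// lee_fin sumr_ge0.
case wm: (ell1_norm w) w_ge0 wC => [m||] //; rewrite !lee_fin => m0 mC.
exists m; split => //.
have L0 : 0 <= Lambda.
  rewrite LE addr_ge0// ?(le_trans _ yQ)// !mulr_ge0// ?sqr_ge0//; lra.
have uB : `|u| <= C by exact: norm_le_ell1.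
have wB : `|w| <= C by apply: norm_le_ell1; rewrite wm lee_fin.
have KBx x : `|x| <= C -> `|K (B x)| <= `|K| * M * C.
  move=> xC; rewrite (le_trans (bounded_op_le _ _))// -mulrA ler_wpM2l//.
  by rewrite (le_trans (bounded_op_le _ _))// ler_pM.
have tail : Lambda * `|K (B w)| <= 2^-1 * m.
  have [L00|Lpos] := eqVneq Lambda 0; first by rewrite L00 mul0r mulr_ge0.
  have {}Lpos : 0 < Lambda by rewrite lt0r Lpos.
  rewrite -ler_pdivlMl// mulrA -bounded_compE.
  apply: (@ell1_tail_le _ _ (bounded_comp K B) N).
  - by rewrite mulr_ge0// invr_ge0.
  - move=> i iN; rewrite (_ : w i = u i - ell2_fin N u i)//.
    by rewrite ell2_finE iN subrr.
  - by move=> i Ni; rewrite bounded_compE ler_pdivlMl// KB.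
  - by rewrite wm.
have Eu : ell2_fin N u = u + - w by rewrite /w opprB subrKC.
(* The cross term contributes |S|^2 |K| M C and the quadratic term half of it, whence the factor 3/2
   in [Lambda]; the pairing with [y] contributes [Q]. *)
have fitE : data_fit B y (ell2_fin N u) <= data_fit B y u + Lambda * `|K (B w)|.
  rewrite Eu data_fitD !bounded_opN !hinnerNr normrN -!addrA lerD2l.
  set k := `|K (B w)|; have k0 : 0 <= k by exact: normr_ge0.
  have Sx x : `|S x| <= `|S| * `|x| by exact: bounded_op_le.
  have b1 : - hinner (S (K (B u))) (S (K (B w))) <= `|S| ^+ 2 * (`|K| * M * C) * k.
    rewrite -hinnerNr (le_trans (hinner_le _ _))// normrN.
    rewrite (@le_trans _ _ ((`|S| * `|K (B u)|) * (`|S| * k)))//.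
      by apply: ler_pM => //; exact: Sx.
    rewrite mulrACA mulrA -expr2; apply: ler_wpM2r; first exact: normr_ge0.
    by apply: ler_wpM2l; [exact: sqr_ge0|exact: KBx].
  have b2 : - - hinner y (K (B w)) <= Q * k.
    by rewrite opprK (le_trans (hinner_le _ _))// ler_wpM2r.
  have b3 : `|S (K (B w))| ^+ 2 <= `|S| ^+ 2 * (`|K| * M * C) * k.
    rewrite (@le_trans _ _ ((`|S| * k) ^+ 2))//.
      by rewrite ler_sqr ?nnegrE ?mulr_ge0//; exact: Sx.
    rewrite (_ : (`|S| * k) ^+ 2 = `|S| ^+ 2 * k * k); last by ring.
    apply: ler_wpM2r; first exact: normr_ge0.
    by apply: ler_wpM2l; [exact: sqr_ge0|exact: KBx].
  rewrite LE; lra.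
rewrite /sparse_objective usplit -/w wm -EFinD lee_fin /supp_objective.
rewrite [X in _ + X + _ <= _](_ : _ = \sum_(i < N) `|u i|); last first.
  by apply: eq_bigr => i _; rewrite ell2_finE ltn_ord.
lra.
Qed.

Lemma supp_objective_continuous N B y : continuous (supp_objective N B y).
Proof.
have gen (T : topologicalType) (f g h : T -> R) : continuous f -> continuous g ->
    continuous h -> continuous (fun t => 2^-1 * f t ^+ 2 - g t + h t).
  move=> fc gc hc t; apply: cvgD; [apply: cvgB|exact: hc]; last exact: gc.
  by apply: cvgM; [exact: cvg_cst|apply: cvgM; exact: fc].
have coordc i : continuous (fun u : ell2 R => `|u i|).
  have [L LE] : exists L : bounded_op (ell2 R) R^o, L =1 (fun u => u i : R^o).
    by apply: (@ex_bounded_op _ _ _ _ 1) => // u; rewrite mul1r; exact: ell2_coord_le.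
  under eq_fun do rewrite -LE.
  move=> u; have := @bounded_op_continuous _ _ _ L u.
  by move=> /cvg_comp; apply; exact: norm_continuous.
have KBc : continuous (fun u : ell2 R => K (B u)).
  by move=> u; apply: (@continuous_comp _ _ _ B K); exact: bounded_op_continuous.
have SKBc : continuous (fun u : ell2 R => `|S (K (B u))|).
  move=> u; have := cvg_comp _ _ (KBc u) (@bounded_op_continuous _ _ _ S (K (B u))).
  by move=> /cvg_comp; apply; exact: norm_continuous.
have hc : continuous (fun u : ell2 R => hinner y (K (B u))).
  have [L LE] : exists L : bounded_op Y R^o, L =1 (hinner y : Y -> R^o).
    apply: (@ex_bounded_op _ _ _ _ `|y|) => [a v w|v]; first by rewrite hinnerDr hinnerZr.
    exact: CauchySchwarz.
  under eq_fun do rewrite -LE.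
  by move=> u; exact: (cvg_comp _ _ (KBc u) (@bounded_op_continuous _ _ _ L _)).
have lc : continuous (fun u : ell2 R => \sum_(i < N) `|u i|).
  by apply: continuous_big => [|i _]; [exact: add_continuous|exact: coordc].
exact: (gen _ _ _ _ SKBc hc lc).
Qed.

End SparseRegularization.

Lemma ge0_of_affine (R : realFieldType) (b c : R) :
  (forall t, 0 < t <= 1 -> 0 <= b + t * c) -> 0 <= b.
Proof.
move=> h; rewrite leNgt; apply/negP => b0.
have c0 : 0 < `|c| + 1 by rewrite ltr_wpDl.
(* If b < 0, this [t] makes t |c| at most -b/2, so that b + t c <= b/2 < 0. *)
pose t := Num.min 1 (- b / (2 * (`|c| + 1))).
have t0 : 0 < t by rewrite lt_min ltr01 divr_gt0 ?mulr_gt0//; lra.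
have t1 : t <= 1 by rewrite ge_min lexx.
have tc : t * (`|c| + 1) <= - b / 2.
  rewrite -ler_pdivlMr// (le_trans (y := - b / (2 * (`|c| + 1))))//.
    by rewrite ge_min lexx orbT.
  by rewrite invfM mulrA.
have := h t; rewrite t0 t1 => /(_ isT).
have : t * c <= t * (`|c| + 1).
  by rewrite ler_pM2l// (le_trans (ler_norm _))// lerDl.
lra.
Qed.

(** * Localization and stability of minimizers *)

Section SparseStability.
Context (R : realType) (X Y Z : hilbertType R).
Context (K : bounded_op X Y) (S : bounded_op Y Z).
Implicit Types (u v w d : ell2 R) (B : bounded_op (ell2 R) X) (y : Y).

(** Along u + t d the data fit is exactly quadratic in t and the l^1 part is convex. Minimality as t
    tends to 0 makes the first-order term nonnegative; at t = 1 the quadratic term is the gain. *)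
Lemma supp_objective_strong_convex N B y u v :
  ell2_supp N u -> ell2_supp N v ->
  (forall w, ell2_supp N w -> supp_objective K S N B y u <= supp_objective K S N B y w) ->
  supp_objective K S N B y u + 2^-1 * `|S (K (B (v - u)))| ^+ 2
    <= supp_objective K S N B y v.
Proof.
move=> uN vN umin; set d := v - u.
pose a := hinner (S (K (B u))) (S (K (B d))) - hinner y (K (B d)).
pose g := `|S (K (B d))| ^+ 2.
pose l w : R := \sum_(i < N) `|(w : ell2 R) i|.
have fitE (t : R) :
    data_fit K S B y (u + t *: d) = data_fit K S B y u + t * a + t ^+ 2 / 2 * g.
  rewrite data_fitD !bounded_opZ !hinnerZr normrZ exprMn real_normK ?num_real//.
  by rewrite /a /g; field.
have lE (t : R) : 0 < t <= 1 -> l (u + t *: d) <= l u + t * (l v - l u).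
  move=> /andP[t0 t1]; rewrite /l -sumrB mulr_sumr -big_split; apply: ler_sum => i _.
  have -> : (u + t *: d) i = (1 - t) * u i + t * v i.
    by rewrite (_ : (u + t *: d) i = u i + t * (v i - u i))//; ring.
  rewrite (le_trans (ler_normD _ _))// !normrM (ger0_norm (ltW t0)) ger0_norm ?subr_ge0//.
  have -> : (1 - t) * `|u i| + t * `|v i| = `|u i| + t * (`|v i| - `|u i|) by ring.
  exact: lexx.
have h : 0 <= a + (l v - l u).
  apply: (@ge0_of_affine _ _ (g / 2)) => t t01.
  have := umin (u + t *: d) (ell2_suppD uN (ell2_suppZ t (ell2_suppB vN uN))).
  rewrite /supp_objective fitE -!/(l _) => h; have := lE t t01.
  case/andP: t01 => t0 _ h2; rewrite -(pmulr_rge0 _ t0); lra.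
have -> : supp_objective K S N B y v = data_fit K S B y (u + 1 *: d) + l v.
  by rewrite scale1r /d subrKC.
rewrite fitE /supp_objective -/(l u) -/g; lra.
Qed.

(** A minimizer over the compact ball [D] of sequences supported below [N] is global, and truncation
    forces every global minimizer into [D]. *)
Lemma sparse_minimizers (BB : set (bounded_op (ell2 R) X)) (Q : R) :
  compact_operator K -> injective S -> 0 <= Q -> compact BB ->
  exists N C, 0 <= C /\ forall B y, BB B -> `|y| <= Q ->
    (exists u, forall v, (sparse_objective K S B y u <= sparse_objective K S B y v)%E) /\
    (forall u, (forall v, sparse_objective K S B y u <= sparse_objective K S B y v)%E ->
       ell2_supp N u /\ `|u| <= C).
Proof.
move=> cK Sinj Q0 cB.
have [M M0 BM] := compact_norm_bounded cB.
have [C C0 HC] := sparse_objective_coercive cK Sinj M0 Q0.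
pose Lambda := `|S| ^+ 2 * (3 / 2) * `|K| * M * C + Q.
have L0 : 0 < Lambda + 1.
  rewrite ltr_wpDl// addr_ge0// !mulr_ge0// ?sqr_ge0//; lra.
have d0 : 0 < 2^-1 / (Lambda + 1) by rewrite divr_gt0.
have [N _ HN] := compact_operator_basis_unif cK cB d0.
exists N, C; split=> // B y BB_B yQ.
have tail i : (N <= i)%N -> Lambda * `|K (B (ell2_basis R i))| <= 2^-1.
  move=> Ni; rewrite (@le_trans _ _ ((Lambda + 1) * `|K (B (ell2_basis R i))|))//.
    by rewrite ler_wpM2r// lerDl.
  by rewrite -ler_pdivlMl// mulrC; exact: (HN N (leqnn N)).
have ell1C v : (sparse_objective K S B y v <= 0)%E -> (ell1_norm v <= C%:E)%E.
  by apply: HC => //; exact: BM.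
have trunc v : (sparse_objective K S B y v <= 0)%E -> exists m,
    [/\ 0 <= m, ell1_norm (v - ell2_fin N v) = m%:E &
    ((supp_objective K S N B y (ell2_fin N v) + 2^-1 * m)%:E
      <= sparse_objective K S B y v)%E].
  move=> /ell1C vC.
  exact: (@sparse_objective_truncate _ _ _ _ _ _
    M Q C Lambda _ _ _ _ erefl M0 C0 (BM _ BB_B)).
split; last first.
  move=> u umin; have u0 : (sparse_objective K S B y u <= 0)%E.
    by rewrite -(sparse_objective0 K S B y).
  have [m [m0 um hm]] := trunc u u0.
  have uN : ell2_supp N u.
    have /(le_trans hm) := umin (ell2_fin N u).
    rewrite (sparse_objective_supp _ _ _ _ (@ell2_supp_fin _ _ _)) lee_fin => h.
    (* Truncation would lower the objective by at least m/2, contradicting minimality unless the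
       tail vanishes. *)
    have m_le0 : m <= 0 by lra.
    have : `|u - ell2_fin N u| <= 0 by apply: norm_le_ell1; rewrite um lee_fin.
    by rewrite normr_le0 subr_eq0 => /eqP ->; exact: ell2_supp_fin.
  by split=> //; apply: norm_le_ell1; exact: ell1C.
pose D := ell2_supp N `&` [set u : ell2 R | `|u| <= C].
have D0 : D 0 by split => //=; rewrite normr0.
have [u] := compact_EVT_min (ex_intro _ _ D0) (@compact_ell2_supp_ball R N C)
  (continuous_subspaceT (@supp_objective_continuous _ _ _ _ K S N B y)).
rewrite inE => -[/= uN uC] umin.
exists u => v; rewrite (sparse_objective_supp _ _ _ _ uN).
(* A competitor with positive objective loses to 0, which lies in [D]; any other is no better than
   its truncation, which lies in [D] by the l^1 bound. *)
have [v0|v0] := leP (sparse_objective K S B y v) 0%E; last first.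
  apply: le_trans (ltW v0).
  rewrite -(sparse_objective0 K S B y) (@sparse_objective_supp _ _ _ _ _ _ N)//.
  by rewrite lee_fin; apply: umin; rewrite inE.
have [m [m0 vm]] := trunc v v0; apply: le_trans; rewrite lee_fin.
rewrite (@le_trans _ _ (supp_objective K S N B y (ell2_fin N v)))//; last first.
  by rewrite lerDl mulr_ge0.
apply: umin; rewrite inE; split; first exact: ell2_supp_fin.
apply: norm_le_ell1; rewrite ell1_norm_fin.
by rewrite (le_trans _ (ell1C v v0))// sum_le_ell1_norm.
Qed.

(** In the sum of the two convexity inequalities the l^1 terms cancel. What remains on the right is
    the increment from [u1] to [u2] of the difference of the data fits, of order |B1 - B2| |d|. *)
Lemma supp_minimizers_lipschitz N (M C1 C2 Q : R) B1 B2 y u1 u2 :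
  0 <= M -> 0 <= C1 -> 0 <= C2 -> 0 <= Q -> `|B1| <= M -> `|B2| <= M -> `|y| <= Q ->
  ell2_supp N u1 -> ell2_supp N u2 -> `|u1| <= C1 -> `|u2| <= C1 ->
  (forall w, ell2_supp N w ->
     supp_objective K S N B1 y u1 <= supp_objective K S N B1 y w) ->
  (forall w, ell2_supp N w ->
     supp_objective K S N B2 y u2 <= supp_objective K S N B2 y w) ->
  (forall w, ell2_supp N w -> `|w| <= C2 * `|S (K (B1 w))|) ->
  (forall w, ell2_supp N w -> `|w| <= C2 * `|S (K (B2 w))|) ->
  `|u2 - u1| <= C2 ^+ 2 * (2 * (`|S| * `|K|) ^+ 2 * M * C1 + Q * `|K|) * `|B1 - B2|.
Proof.
move=> M0 C10 C20 Q0 B1M B2M yQ u1N u2N u1C u2C u1min u2min B1C B2C.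
set d := u2 - u1; pose E := B1 - B2; pose F := B1 + B2.
set Gamma := _ + Q * `|K|.
have dN : ell2_supp N d by exact: ell2_suppB.
pose G x := S (K x).
have GD x x' : G (x + x') = G x + G x' by rewrite /G !bounded_opD.
have GB x x' : G (x - x') = G x - G x' by rewrite /G !bounded_opB.
have Gx x : `|G x| <= (`|S| * `|K|) * `|x|.
  by rewrite (le_trans (bounded_op_le _ _))// -mulrA ler_wpM2l// bounded_op_le.
have FM w : `|G (F w)| <= (`|S| * `|K|) * (2 * M * `|w|).
  rewrite (le_trans (Gx _))// ler_wpM2l ?mulr_ge0// (le_trans (bounded_op_le _ _))//.
  by rewrite ler_wpM2r// (le_trans (ler_normD _ _))//; lra.
have EM w : `|G (E w)| <= (`|S| * `|K|) * (`|E| * `|w|).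
  by rewrite (le_trans (Gx _))// ler_wpM2l ?mulr_ge0//; exact: bounded_op_le.
(* Polarization: |a|^2 - |b|^2 = <a - b, a + b>, which extracts the factor [E]. *)
have diffE w : data_fit K S B1 y w - data_fit K S B2 y w =
    2^-1 * hinner (G (E w)) (G (F w)) - hinner y (K (E w)).
  rewrite /data_fit -!hinner_norm -!/(G _).
  rewrite (_ : E w = B1 w - B2 w)// (_ : F w = B1 w + B2 w)//.
  by rewrite GB GD bounded_opB !hinnerE (hinnerC (G (B2 w)) (G (B1 w))); field.
have key : data_fit K S B1 y u2 - data_fit K S B2 y u2
    - (data_fit K S B1 y u1 - data_fit K S B2 y u1) <= Gamma * `|E| * `|d|.
  rewrite !diffE.
  have u2E : u2 = u1 + d by rewrite /d subrKC.
  (* Increment of a bilinear form: one term has [d] in the first slot, the other in the second. *)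
  have Ed : hinner (G (E u2)) (G (F u2)) - hinner (G (E u1)) (G (F u1)) =
      hinner (G (E d)) (G (F u2)) + hinner (G (E u1)) (G (F d)).
    by rewrite {1 3}u2E !bounded_opD !GD !hinnerE; ring.
  have b1 : hinner (G (E d)) (G (F u2)) <= 2 * (`|S| * `|K|) ^+ 2 * M * C1 * `|E| * `|d|.
    rewrite (le_trans (hinner_le _ _))//.
    rewrite (@le_trans _ _ ((`|S| * `|K|) * (`|E| * `|d|)
        * ((`|S| * `|K|) * (2 * M * C1))))//.
      apply: ler_pM; [exact: normr_ge0|exact: normr_ge0|exact: EM|].
      by rewrite (le_trans (FM _))// ler_wpM2l ?mulr_ge0// ler_wpM2l// mulr_ge0.
    by rewrite le_eqVlt; apply/orP; left; apply/eqP; ring.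
  have b2 : hinner (G (E u1)) (G (F d)) <= 2 * (`|S| * `|K|) ^+ 2 * M * C1 * `|E| * `|d|.
    rewrite (le_trans (hinner_le _ _))//.
    rewrite (@le_trans _ _ ((`|S| * `|K|) * (`|E| * C1)
        * ((`|S| * `|K|) * (2 * M * `|d|))))//.
      apply: ler_pM; [exact: normr_ge0|exact: normr_ge0| |exact: FM].
      by rewrite (le_trans (EM _))// ler_wpM2l ?mulr_ge0// ler_wpM2l.
    by rewrite le_eqVlt; apply/orP; left; apply/eqP; ring.
  have b3 : - hinner y (K (E d)) <= Q * `|K| * `|E| * `|d|.
    rewrite -hinnerNr (le_trans (hinner_le _ _))// normrN -!mulrA.
    apply: ler_pM => //; rewrite (le_trans (bounded_op_le _ _))// ler_wpM2l//.
    exact: bounded_op_le.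
  have Kd : hinner y (K (E u2)) = hinner y (K (E u1)) + hinner y (K (E d)).
    by rewrite u2E (bounded_opD E) (bounded_opD K) hinnerDr.
  rewrite Kd /Gamma !mulrDl; lra.
have h1 := supp_objective_strong_convex u1N u2N u1min.
have h2 := supp_objective_strong_convex u2N u1N u2min.
have sq B : (forall w, ell2_supp N w -> `|w| <= C2 * `|S (K (B w))|) ->
    `|d| ^+ 2 <= C2 ^+ 2 * `|S (K (B d))| ^+ 2.
  by move=> BC; rewrite -exprMn ler_sqr ?nnegrE ?mulr_ge0// BC.
have {}h2 : supp_objective K S N B2 y u2 + 2^-1 * `|S (K (B2 d))| ^+ 2
    <= supp_objective K S N B2 y u1.
  by move: h2; rewrite -(opprB u2 u1) -/d !bounded_opN normrN.
(* Each of the two halves on the left is at least |d|^2 / 2 after multiplication by C2^2. *)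
have main : `|d| ^+ 2 <= C2 ^+ 2 * Gamma * `|E| * `|d|.
  have : 2^-1 * `|S (K (B1 d))| ^+ 2 + 2^-1 * `|S (K (B2 d))| ^+ 2 <= Gamma * `|E| * `|d|.
    by move: h1 h2 key; rewrite /supp_objective -/d; lra.
  move=> /(ler_wpM2l (sqr_ge0 C2)); rewrite !mulrA.
  by have := sq _ B1C; have := sq _ B2C; lra.
have [->|dn0] := eqVneq d 0.
  by rewrite normr0 !mulr_ge0// ?sqr_ge0// addr_ge0 ?mulr_ge0// ?sqr_ge0.
have nd : 0 < `|d| by rewrite normr_gt0.
by move: main; rewrite expr2 ler_pM2r.
Qed.

End SparseStability.

(** * Return to the reconstruction map *)

Lemma ell2_supp_span (R : realType) N (u : ell2 R) :
  ell2_supp N u -> ell2_span [fset i in iota 0 N]%fset u.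
Proof.
move=> uN; exists u; rewrite -{1}(ell2_suppE uN) /ell2_fin.
rewrite -(big_mkord xpredT (fun i => u i *: ell2_basis R i)) /index_iota subn0.
apply: perm_big; apply: uniq_perm; rewrite ?iota_uniq ?fset_uniq// => i.
by rewrite !inE.
Qed.

Theorem theorem2p5 (R : realType) (X Y : hilbertType R)
    (sepX : separable X) (sepY : separable Y)
    (A : bounded_op X Y) (Sigma : bounded_op Y Y)
    (covSigma : covariance_operator Sigma) (injSigma : injective Sigma)
    (compatSigmaA : compatible A Sigma)
    (Bset : set (bounded_op (ell2 R) X)) (compactB : compact Bset)
    (fbiB : forall B, Bset B -> finite_basis_injective A B)
    (Q : R) (Q_ge0 : 0 <= Q) :
  exists cST : R, forall (y : Y), `|y| <= Q ->
    forall B1 B2, Bset B1 -> Bset B2 ->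
    `|reconstruction A Sigma B1 y - reconstruction A Sigma B2 y|
      <= cST * `|B1 - B2|.
Proof.
have [ranA cK0] := compatSigmaA.
have [K KE] := compact_operator_bounded cK0.
have cK : compact_operator K by rewrite (funext KE).
pose S := op_sqrt Sigma.
have [_ SS] := op_sqrtP (covariance_positive covSigma).
have Sinj : injective S.
  by move=> a b ab; apply: injSigma; rewrite -!SS -/S ab.
(* The range inclusion in the compatibility assumption ensures that [range_inv Sigma] is a true
   inverse at [A x], not its default 0. *)
have SKE x : S (S (K x)) = A x.
  have [z _ zA] : range Sigma (A x) by apply: ranA; exists x.
  by rewrite SS KE /= -zA range_invK.
(* As A x = S (S K x) and [S] is injective, [range_inv S] sends A x to S K x. *)
have objE B y u : objective A Sigma B y u = sparse_objective K S B y u.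
  rewrite /objective /sparse_objective /data_fit -SKE range_invK//.
  by rewrite SKE -[range_inv Sigma _]/((range_inv Sigma \o A) (B u)) -KE.
have [N [C1 [C10 HN]]] := sparse_minimizers cK Sinj Q_ge0 compactB.
have [|C2 C20 HC2] := @ell2_supp_lower_bound_unif R X Y (bounded_comp S K) Bset N compactB.
  (* S K B u = 0 gives A B u = S (S K B u) = 0 = A B 0, and finite basis injectivity on the first
     [N] basis vectors yields u = 0. *)
  move=> B BB u uN; rewrite bounded_compE => SKBu.
  apply: (fbiB _ BB [fset i in iota 0 N]%fset); rewrite ?inE.
  - exact: ell2_supp_span.
  - by apply: ell2_supp_span.
  - by rewrite /= -!SKE SKBu !bounded_op0.
have [M M0 BM] := compact_norm_bounded compactB.
pose Gamma := C2 ^+ 2 * (2 * (`|S| * `|K|) ^+ 2 * M * C1 + Q * `|K|).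
(* [C1] bounds |u1| in (B1 - B2) u1, and [M * Gamma] accounts for B2 (u2 - u1); every constant is
   fixed before [y], [B1] and [B2]. *)
exists (C1 + M * Gamma) => y yQ B1 B2 BB1 BB2.
have min_spec B : Bset B -> let u := minimizer A Sigma B y in
    [/\ ell2_supp N u, `|u| <= C1 & forall w, ell2_supp N w ->
      supp_objective K S N B y u <= supp_objective K S N B y w].
  move=> BB; have [[v vmin] Hmin] := HN B y BB yQ.
  (* Existence of a minimizer excludes the default 0 of [xget]. *)
  have umin w : (sparse_objective K S B y (minimizer A Sigma B y)
      <= sparse_objective K S B y w)%E.
    rewrite -!objE; move: w; rewrite /minimizer.
    apply: (@xgetPex _ 0
      [set u | forall w, (objective A Sigma B y u <= objective A Sigma B y w)%E]).
    by exists v => w; rewrite !objE.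
  have [uN uC] := Hmin _ umin; split => // w wN.
  by rewrite -lee_fin -!sparse_objective_supp.
have [u1N u1C u1min] := min_spec _ BB1; have [u2N u2C u2min] := min_spec _ BB2.
have lower B : Bset B -> forall w, ell2_supp N w -> `|w| <= C2 * `|S (K (B w))|.
  by move=> BB w wN; rewrite -bounded_compE; exact: HC2.
have := supp_minimizers_lipschitz M0 C10 C20 Q_ge0 (BM _ BB1) (BM _ BB2) yQ
  u1N u2N u1C u2C u1min u2min (lower _ BB1) (lower _ BB2).
rewrite -/Gamma /reconstruction.
move: u1C; set u1 := minimizer _ _ B1 _; set u2 := minimizer _ _ B2 _ => u1C u12.
have -> : B1 u1 - B2 u2 = (B1 - B2) u1 - B2 (u2 - u1).
  by rewrite (_ : (B1 - B2) u1 = B1 u1 - B2 u1)// bounded_opB opprB addrA subrK.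
rewrite (le_trans (ler_normB _ _))// mulrDl lerD//.
  by rewrite (le_trans (bounded_op_le _ _))// mulrC ler_wpM2r.
rewrite (le_trans (bounded_op_le _ _))// -mulrA; apply: ler_pM => //.
exact: BM.
Qed.
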